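(* Let $(w(k))_{k\ge1}$ be a sequence of real numbers with $w(k)\to\infty$ as $k\to\infty$. Then there exists a sequence of integers $(r(k))_{k\ge1}$ with $r(k)=o(w(k))$ as $k\to\infty$ such that the set $$\Lambda=\{k^2+r(k): k\ge1\}$$ is contained in $\mathbb{Z}^+$ and is a Menshov spectrum in measure.
   Context: $\mathbb{Z}^+=\{1,2,\ldots\}$; $\mathbb{T}=\mathbb{R}/2\pi\mathbb{Z}$ with normalized Lebesgue measure; $L^0(\mathbb{T})$ is the space of all measurable functions $f:\mathbb{T}\to\mathbb{C}$. A set $\Lambda\subset\mathbb{Z}$ is a Menshov spectrum in measure if for every $f\in L^0(\mathbb{T})$ there are complex coefficients $(c_k)_{k\in\Lambda}$ such that the partial sums $\sum_{k\in\Lambda,\,|k|\le N}c_k e^{ikt}$ converge to $f$ in measure on $\mathbb{T}$ as $N\to\infty$. *)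

(* Defs.v *)
From mathcomp Require Import all_boot all_order all_algebra.
From mathcomp Require Import complex.
From mathcomp Require Import all_classical all_reals all_analysis.

Set Implicit Arguments.
Unset Strict Implicit.
Unset Printing Implicit Defensive.
Import Order.TTheory GRing.Theory Num.Theory.
Import numFieldNormedType.Exports.

Local Open Scope classical_set_scope.
Local Open Scope ring_scope.
Local Open Scope complex_scope.

(* Functions on T = R/2piZ are 2pi-periodic functions on R; a set of points of
   T is given by its preimage in R, only its part in [0, 2pi[ being measured. *)

(* R with the Lebesgue (not just Borel) sigma-algebra, which is the domain of
   [completed_lebesgue_measure]. *)
Definition lebesgue_type (R : realType) : measurableType _ :=
  caratheodory_type (mu_ext (wlength (@idfun R))).

Definition torus_measure (R : realType) (E : set R) : \bar R :=
  (((pi *+ 2)^-1)%:E *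
   @completed_lebesgue_measure R (E `&` `[0%R, (pi *+ 2)%R[%classic))%E.

(* R[i] carries no sigma-algebra in the library: its Borel sigma-algebra being
   that of R^2, measurability is that of the real and imaginary parts. *)
Definition torus_L0 (R : realType) : set (R -> R[i]) :=
  [set f | [/\ periodic f (pi *+ 2),
     measurable_fun setT
       ((fun t => complex.Re (f t)) : lebesgue_type R -> measurableTypeR R) &
     measurable_fun setT
       ((fun t => complex.Im (f t)) : lebesgue_type R -> measurableTypeR R)]].

Definition cvg_in_torus_measure (R : realType)
    (F : nat -> R -> R[i]) (f : R -> R[i]) : Prop :=
  forall eps : R, 0 < eps ->
    torus_measure [set t | eps%:C <= `|F N t - f t|] @[N --> \oo] --> 0%E.

(* t |-> e^{ikt} *)
Definition character (R : realType) (k : int) (t : R) : R[i] :=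
  cos (k%:~R * t) +i* sin (k%:~R * t).

Definition partial_sum (R : realType) (Lambda : set int) (c : int -> R[i])
    (N : nat) (t : R) : R[i] :=
  \sum_(k \in [set k | Lambda k /\ `|k| <= N%:Z]) c k * character k t.

(* Only the values of [c] on [Lambda] matter. *)
Definition menshov_spectrum_in_measure (R : realType) (Lambda : set int) : Prop :=
  forall f : R -> R[i], torus_L0 f ->
    exists c : int -> R[i], cvg_in_torus_measure (partial_sum Lambda c) f.

(* Main.v *)
Require Import Defs.
From mathcomp Require Import all_boot all_order all_algebra.
From mathcomp Require Import complex.
From mathcomp Require Import all_classical all_reals all_analysis.
From mathcomp Require Import ring lra zify.

Import Order.TTheory GRing.Theory Num.Theory.
Import numFieldNormedType.Exports.

Local Open Scope classical_set_scope.
Local Open Scope ring_scope.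

(** Write the frequencies near A^2 as (A + j)^2 + (s - j^2) = A^2 + 2Aj + s. The
    shifts r are chosen so that every finite pattern {(j, s)} occurs around
    arbitrarily large A, so late that the shifts involved are negligible
    compared with w.

    Since 1 + sum_{l <> 0} r^|l| e^{il(2ANt)} is a Poisson kernel, which for r
    close to 1 is small off a small set, e^{iA^2 t} g(t) can be approximated in
    measure by such frequencies for every trigonometric polynomial
    g = sum_s g_s e^{ist}: spend on each s its own multiple N_s of frequencies
    2A N_s l, l <> 0. The coefficient g may be any function of what was built
    earlier, as A is much larger than all previous frequencies.

    A residual f is then driven to a small disc by a planar random walk with
    small steps e^{iA^2 t} g(t), where g vanishes once the residual is small:
    planar Brownian motion is recurrent. Instead of randomness, the phase of
    each step is chosen among 1, i, -1, -i so as not to decrease the mean of the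
    potential 4/(1+|z|^2) - ln(1+|z|^2), subharmonic for |z|^2 >= 2 and
    logarithmic at infinity. Splitting f into many small pieces makes all
    intermediate partial sums small in measure relative to f, and summing
    successive corrections gives the series. *)

Set Implicit Arguments.
Unset Strict Implicit.
Unset Printing Implicit Defensive.
Import ComplexField.Normc ComplexField.

Local Open Scope complex_scope.

(** * Complex modulus and trigonometric polynomials *)

(** The residual cannot be kept bounded, only bounded in measure, and the potential serves this
    twice. It is at most 4, so its mean can rise by a fixed amount only finitely often, which forces
    the walk to stop. It tends to minus infinity like a logarithm, so a lower bound on its mean
    bounds the walk in measure at every intermediate moment, by a constant that depends on f but not
    on the final exceptional set.

    This independence is what makes the splitting work. Approximating K f within 3 and dividing by K
    leaves the error 3/K. The bound on the intermediate sums is then divided by the number L of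
    pieces, and the exceptional sets, shrunk after L is known, still add up to little.

    Inside a block the choices are ordered in the same way. Its partial sums are bounded off a small
    set by a constant that does not depend on how well the full block approximates its target. A
    factor 1/L makes them small, the walk takes L^2 such steps to recover a fixed variance, and the
    accuracy of each block is chosen after L. *)

Section Modulus.
Context {R : realType}.
Implicit Types z w : R[i].

Definition sqn z : R := complex.Re z ^+ 2 + complex.Im z ^+ 2.

Lemma sqn_normc z : sqn z = normc z ^+ 2.
Proof.
by case: z => a b; rewrite /sqn /normc /= sqr_sqrtr // addr_ge0 ?sqr_ge0.
Qed.

Lemma normc_ge0 z : 0 <= normc z.
Proof. by case: z => a b; rewrite /normc sqrtr_ge0. Qed.

Lemma sqn_ge0 z : 0 <= sqn z.
Proof. by rewrite sqn_normc exprn_ge0 ?normc_ge0. Qed.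

Lemma normc_real (x : R) : normc x%:C = `|x|.
Proof. by rewrite /normc /= expr0n /= addr0 sqrtr_sqr. Qed.

Lemma lec_normc (x : R) z : (x%:C <= `|z|) = (x <= normc z).
Proof. by rewrite -lecR. Qed.

Lemma normcD z w : normc (z + w) <= normc z + normc w.
Proof. exact: le_normcD. Qed.

Lemma normcNE z : normc (- z) = normc z.
Proof. exact: normcN. Qed.

Lemma normcB z w : normc (z - w) = normc (w - z).
Proof. by rewrite -normcNE opprB. Qed.

Lemma normc_sum (I : Type) (s : seq I) (F : I -> R[i]) :
  normc (\sum_(i <- s) F i) <= \sum_(i <- s) normc (F i).
Proof.
elim: s => [|i s IH]; first by rewrite !big_nil normc0.
by rewrite !big_cons (le_trans (le_normcD _ _)) // lerD2l.
Qed.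

Lemma normcX z n : normc (z ^+ n) = normc z ^+ n.
Proof. by elim: n => [|n IH]; rewrite ?normc1 // !exprS normcM IH. Qed.

Definition cj z : R[i] := z^*.

Lemma cjB z w : cj (z - w) = cj z - cj w. Proof. exact: rmorphB. Qed.
Lemma cjM z w : cj (z * w) = cj z * cj w. Proof. exact: rmorphM. Qed.
Lemma cjX z n : cj (z ^+ n) = cj z ^+ n. Proof. exact: rmorphXn. Qed.
Lemma cj1 : cj 1 = 1. Proof. exact: rmorph1. Qed.
Lemma cjK : involutive cj. Proof. exact: conjcK. Qed.
Lemma cjR (x : R) : cj x%:C = x%:C. Proof. exact: conjc_real. Qed.
Lemma cj_sum (I : Type) (s : seq I) (P : pred I) (F : I -> R[i]) :
  cj (\sum_(i <- s | P i) F i) = \sum_(i <- s | P i) cj (F i).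
Proof. exact: rmorph_sum. Qed.

Lemma sqn_conj z : (sqn z)%:C = z * cj z.
Proof. by rewrite sqn_normc -sqr_normc rmorphXn. Qed.

Lemma normc_conj z : normc (cj z) = normc z.
Proof. by case: z => a b; rewrite /cj /normc /= sqrrN. Qed.

End Modulus.

Section TrigonometricPolynomials.
Context {R : realType}.
Implicit Types (k : int) (t : R) (P Q : seq (int * R[i])).

Lemma characterD k l t :
  character (k + l) t = character k t * character l t :> R[i].
Proof.
rewrite /character intrD mulrDl cosD sinD; apply/eqP.
by rewrite eq_complex /= eqxx addrC eqxx.
Qed.

Lemma character0 t : character 0 t = 1 :> R[i].
Proof. by rewrite /character mul0r cos0 sin0. Qed.

Lemma normc_character k t : normc (character k t) = 1 :> R.
Proof. by rewrite /normc /character cos2Dsin2 sqrtr1. Qed.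

Lemma character_conj k t : cj (character k t) = character (- k) t :> R[i].
Proof. by rewrite /cj /character intrN mulNr cosN sinN. Qed.

Lemma characterX k n t :
  character (k * n%:Z) t = character k t ^+ n :> R[i].
Proof.
elim: n => [|n IH]; first by rewrite mulr0 character0.
by rewrite -addn1 PoszD mulrDr mulr1 characterD IH exprD expr1.
Qed.

Definition teval P t : R[i] := \sum_(x <- P) x.2 * character x.1 t.

Definition trunc (N : int) P := [seq x <- P | x.1 <= N].


Lemma teval_nil t : teval [::] t = 0.
Proof. by rewrite /teval big_nil. Qed.

Lemma teval_cons x P t : teval (x :: P) t = x.2 * character x.1 t + teval P t.
Proof. by rewrite /teval big_cons. Qed.

Lemma teval_cat P Q t : teval (P ++ Q) t = teval P t + teval Q t.
Proof. by rewrite /teval big_cat. Qed.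

Definition tscale (a : R[i]) P := [seq (x.1, a * x.2) | x <- P].

Lemma teval_scale a P t : teval (tscale a P) t = a * teval P t.
Proof.
rewrite /teval /tscale big_map mulr_sumr.
by apply: eq_bigr => x _; rewrite mulrA.
Qed.

Lemma trunc_cat N P Q : trunc N (P ++ Q) = trunc N P ++ trunc N Q.
Proof. exact: filter_cat. Qed.

Lemma trunc_scale N a P : trunc N (tscale a P) = tscale a (trunc N P).
Proof. by rewrite /trunc /tscale filter_map. Qed.

Definition trigp (f : R -> R[i]) := exists P, forall t, f t = teval P t.

Lemma trigp_teval P : trigp (teval P).
Proof. by exists P. Qed.

Lemma trigp_ext f g : (forall t, f t = g t) -> trigp f -> trigp g.
Proof. by move=> fg [P fP]; exists P => t; rewrite -fg. Qed.

Lemma trigp_char k : trigp (character k).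
Proof. by exists [:: (k, 1)] => t; rewrite teval_cons teval_nil mul1r addr0. Qed.

Lemma trigpD f g : trigp f -> trigp g -> trigp (fun t => f t + g t).
Proof.
by move=> [P fP] [Q gQ]; exists (P ++ Q) => t; rewrite teval_cat fP gQ.
Qed.

Lemma trigpZ a f : trigp f -> trigp (fun t => a * f t).
Proof. by move=> [P fP]; exists (tscale a P) => t; rewrite teval_scale fP. Qed.

Lemma trigp_cst a : trigp (fun=> a).
Proof.
by apply: trigp_ext (trigpZ a (trigp_char 0)) => t; rewrite character0 mulr1.
Qed.

Lemma trigpB f g : trigp f -> trigp g -> trigp (fun t => f t - g t).
Proof.
move=> tf tg; apply: trigp_ext (trigpD tf (trigpZ (-1) tg)) => t.
by rewrite mulN1r.
Qed.

Lemma trigpM f g : trigp f -> trigp g -> trigp (fun t => f t * g t).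
Proof.
move=> [P fP] [Q gQ].
suff tM : trigp (fun t => teval P t * teval Q t).
  by apply: trigp_ext tM => t; rewrite fP gQ.
elim: P {fP} => [|x P IH].
  by apply: trigp_ext (trigp_cst 0) => t; rewrite teval_nil mul0r.
pose Q' := [seq (x.1 + y.1, x.2 * y.2) | y <- Q].
apply: trigp_ext (trigpD (trigp_teval Q') IH) => t.
rewrite teval_cons mulrDl; congr (_ + _).
rewrite /teval big_map mulr_sumr; apply: eq_bigr => y _ /=.
by rewrite characterD mulrACA.
Qed.

Lemma trigp_conj f : trigp f -> trigp (fun t => cj (f t)).
Proof.
move=> [P fP]; exists [seq (- x.1, cj x.2) | x <- P] => t.
rewrite fP /teval big_map cj_sum; apply: eq_bigr => x _ /=.
by rewrite cjM character_conj.
Qed.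

Lemma trigp_sqn f : trigp f -> trigp (fun t => (sqn (f t))%:C).
Proof.
move=> tf; apply: trigp_ext (trigpM tf (trigp_conj tf)) => t.
by rewrite sqn_conj.
Qed.

Lemma trigp_horner (q : {poly R}) (u : R -> R) :
  trigp (fun t => (u t)%:C) -> trigp (fun t => (q.[u t])%:C).
Proof.
move=> tu; elim/poly_ind: q => [|q c IH].
  by apply: trigp_ext (trigp_cst 0) => t; rewrite horner0.
apply: trigp_ext (trigpD (trigpM IH tu) (trigp_cst c%:C)) => t.
by rewrite hornerMXaddC rmorphD rmorphM.
Qed.

Lemma trigp_bounded f : trigp f -> exists2 B, 0 <= B & forall t, normc (f t) <= B.
Proof.
move=> [P fP]; exists (\sum_(x <- P) normc x.2).
  by apply: sumr_ge0 => x _; exact: normc_ge0.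
move=> t; rewrite fP (le_trans (normc_sum _ _)) //.
by apply: ler_sum => x _; rewrite normcM normc_character mulr1.
Qed.

Lemma trigp_continuous f : trigp f ->
  continuous (fun t => complex.Re (f t)) /\ continuous (fun t => complex.Im (f t)).
Proof.
move=> [P fP].
have cc k : continuous (fun t => cos (k%:~R * t)).
  move=> t; apply: (@continuous_comp _ _ _ (fun t : R => k%:~R * t) cos).
    by apply: cvgM; [exact: cvg_cst|exact: cvg_id].
  exact: continuous_cos.
have cs k : continuous (fun t => sin (k%:~R * t)).
  move=> t; apply: (@continuous_comp _ _ _ (fun t : R => k%:~R * t) sin).
    by apply: cvgM; [exact: cvg_cst|exact: cvg_id].
  exact: continuous_sin.
suff [cR cI] : continuous (fun t => complex.Re (teval P t)) /\
    continuous (fun t => complex.Im (teval P t)).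
  have -> : f = teval P by apply/funext => t; exact: fP.
  by [].
elim: P {fP} => [|[k [a b]] P [cR cI]].
  have -> : teval [::] = (fun=> 0) by apply/funext => t; rewrite teval_nil.
  by split => t; exact: cvg_cst.
have -> : teval ((k, a +i* b) :: P) = (fun t =>
    (a * cos (k%:~R * t) - b * sin (k%:~R * t) + complex.Re (teval P t)) +i*
    (a * sin (k%:~R * t) + b * cos (k%:~R * t) + complex.Im (teval P t))).
  apply/funext => t; rewrite teval_cons /= /character; case: (teval P t) => c d.
  by apply/eqP; rewrite eq_complex /= !eqxx.
split=> t /=.
  apply: cvgD; last exact: cR.
  by apply: cvgB; apply: cvgM; [exact: cvg_cst|exact: cc|exact: cvg_cst|exact: cs].
apply: cvgD; last exact: cI.
by apply: cvgD; apply: cvgM; [exact: cvg_cst|exact: cs|exact: cvg_cst|exact: cc].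
Qed.

Lemma trigp_continuous_sqn f : trigp f -> continuous (fun t => sqn (f t)).
Proof.
move=> /trigp_continuous[cR cI] t; rewrite /sqn.
by apply: cvgD; rewrite /GRing.exp /=; apply: cvgM; [exact: cR|exact: cR|exact: cI|exact: cI].
Qed.

End TrigonometricPolynomials.

Arguments normc : simpl never.
Arguments sqn : simpl never.
Arguments cj : simpl never.
Arguments character : simpl never.

(** * Measure and mean on the circle *)

Section TorusMeasure.
Context {R : realType}.
Implicit Types (E F : set R) (d e : R).
Local Notation tau := (pi *+ 2 : R).
Local Notation mu := (@lebesgue_measure R).

(* torus_measure is an outer measure, monotone and subadditive on all sets, so
   that no measurability is needed here. *)
Definition tmle E d : Prop := (torus_measure E <= d%:E)%E.

Lemma tau_gt0 : 0 < tau.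
Proof. by rewrite mulrn_wgt0 // pi_gt0. Qed.

Lemma tmleE E d : tmle E d <-> (mu (E `&` `[0%R, tau[) <= (tau * d)%:E)%E.
Proof.
rewrite /tmle /torus_measure.
(* Both measures unfold to the same outer measure, so they agree by computation even on
   nonmeasurable sets. *)
rewrite (_ : completed_lebesgue_measure _ = mu (E `&` `[0%R, tau[)) //.
by rewrite muleC lee_pdivrMr ?tau_gt0 // -EFinM mulrC.
Qed.

Lemma mu_le E F : E `<=` F -> (mu E <= mu F)%E.
Proof. exact: (@le_outer_measure _ _ ((wlength (@idfun R))^*)%mu). Qed.

Lemma muU_le E F : (mu (E `|` F) <= mu E + mu F)%E.
Proof.
exact: (@outer_measureU2 _ _ ((wlength (@idfun R))^*)%mu).
Qed.

Lemma tmle_sub E F d : (forall t, 0 <= t < tau -> E t -> F t) ->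
  tmle F d -> tmle E d.
Proof.
move=> EF /tmleE Fd; apply/tmleE; apply: le_trans Fd; apply: mu_le.
by move=> t /= [Et]; rewrite in_itv /= => t0; split => //; exact: EF.
Qed.

Lemma tmle_trans E d e : d <= e -> tmle E d -> tmle E e.
Proof. by move=> de /le_trans; apply; rewrite lee_fin. Qed.

Lemma tmleU E F d e : tmle E d -> tmle F e -> tmle (E `|` F) (d + e).
Proof.
move=> /tmleE Ed /tmleE Fe; apply/tmleE.
rewrite setIUl (le_trans (muU_le _ _)) // mulrDr EFinD.
exact: leeD.
Qed.

Lemma tmle0 d : 0 <= d -> tmle set0 d.
Proof.
move=> d0; apply/tmleE; rewrite set0I measure0 lee_fin mulr_ge0 //.
by rewrite ltW // tau_gt0.
Qed.

(** The interval is closed, unlike that of [torus_measure]: compactness makes continuous functions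
    integrable. *)
Definition mean (f : R -> R) : R := tau^-1 * \int[mu]_(x in `[0, tau]) f x.

Lemma mean_integrable (f : R -> R) : continuous f -> mu.-integrable `[0, tau] (EFin \o f).
Proof.
move=> cf; apply: continuous_compact_integrable; first exact: segment_compact.
exact: continuous_subspaceT.
Qed.

Let mtau : measurable (`[0, tau] : set (measurableTypeR R)).
Proof. exact: measurable_itv. Qed.

Lemma meanD (f g : R -> R) : continuous f -> continuous g ->
  mean (fun t => f t + g t) = mean f + mean g.
Proof.
move=> cf cg; rewrite /mean RintegralD //; [by rewrite mulrDr|exact: mean_integrable..].
Qed.

Lemma meanZ (a : R) (f : R -> R) : continuous f -> mean (fun t => a * f t) = a * mean f.
Proof.
by move=> cf; rewrite /mean RintegralZl //; [rewrite mulrCA|exact: mean_integrable].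
Qed.

Lemma mean_le (f g : R -> R) : continuous f -> continuous g -> (forall t, f t <= g t) ->
  mean f <= mean g.
Proof.
move=> cf cg fg; rewrite /mean ler_pM2l ?invr_gt0 ?tau_gt0 //.
apply: le_Rintegral => //; exact: mean_integrable.
Qed.

Lemma mean_cst (a : R) : mean (fun=> a) = a.
Proof.
have mE : fine (mu `[0, tau]) = tau.
  by rewrite lebesgue_measure_itv /= lte_fin tau_gt0 /= subr0.
rewrite /mean Rintegral_cst // mE.
by rewrite mulrCA mulVf ?mulr1 // gt_eqF // tau_gt0.
Qed.

Lemma mean_ge0 (f : R -> R) : (forall t, 0 <= f t) -> 0 <= mean f.
Proof.
by move=> f0; rewrite /mean mulr_ge0 ?invr_ge0 ?(ltW tau_gt0) ?Rintegral_ge0.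
Qed.

Lemma tmle_chebyshev (f : R -> R) (a : R) : continuous f -> (forall t, 0 <= f t) -> 0 < a ->
  tmle [set t | a <= f t] (mean f / a).
Proof.
move=> cf f0 a0; apply/tmleE.
have intf := mean_integrable cf.
have /integrableP[mf _] := intf.
have /= H := le_integral_comp_abse mu mtau (@measurable_id _ _ setT)
  (fun _ h => h) (fun _ _ _ _ h => h) mf a0.
rewrite muleC -lee_pdivlMr // in H.
apply: le_trans (le_trans (mu_le _) H) _.
  move=> t /= [at_]; rewrite !in_itv /= => /andP[t0 /ltW t1].
  by rewrite t0 t1 /= lee_fin ger0_norm //; split.
rewrite le_eqVlt; apply/orP; left; apply/eqP.
have -> : tau * (mean f / a) = (\int[mu]_(x in `[0, tau]) f x) / a.
  by rewrite /mean mulrA mulrA divff ?mul1r // gt_eqF // tau_gt0.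
rewrite /Rintegral EFinM fineK; last exact: integrable_fin_num.
congr (_ * _)%E; apply: eq_integral => x _ /=. 
by rewrite ger0_norm.
Qed.

End TorusMeasure.

(** * Mean squares of geometric sums, and the set where a character is close to 1 *)

Section RootsOfUnity.
Context {R : realType}.
Local Notation tau := (pi *+ 2 : R).

Lemma sin_int2pi (k : int) : sin (k%:~R * tau) = 0.
Proof.
have sinn (n : nat) : sin (n%:R * tau) = 0.
  by have := periodicn (@sinD2pi R) n 0; rewrite sin0 add0r -[_ *+ n]mulr_natl.
case: k => n; first exact: sinn.
by rewrite NegzE intrN mulNr sinN sinn oppr0.
Qed.

Lemma mean_cos (k : int) : k != 0 -> mean (fun t : R => cos (k%:~R * t)) = 0.
Proof.
move=> k0; have kR : k%:~R != 0 :> R by rewrite intr_eq0.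
have cc : continuous (fun t : R => cos (k%:~R * t)).
  move=> t; apply: (@continuous_comp _ _ _ (fun t : R => k%:~R * t) cos).
    by apply: cvgM; [exact: cvg_cst|exact: cvg_id].
  exact: continuous_cos.
have cs : continuous (fun t : R => k%:~R^-1 * sin (k%:~R * t)).
  move=> t; apply: cvgM; first exact: cvg_cst.
  apply: (@continuous_comp _ _ _ (fun t : R => k%:~R * t) sin).
    by apply: cvgM; [exact: cvg_cst|exact: cvg_id].
  exact: continuous_sin.
have dF (t : R) : is_derive t 1 (fun t : R => k%:~R^-1 * sin (k%:~R * t)) (cos (k%:~R * t)).
  apply: is_derive_eq.
  by rewrite /GRing.scale /= mulr1 mulrCA mulVf ?mulr1.
rewrite /mean /Rintegral (@continuous_FTC2 _ _ (fun t : R => k%:~R^-1 * sin (k%:~R * t))).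
- by rewrite sin_int2pi !mulr0 sin0 !mulr0 -EFinB /= subrr mulr0.
- exact: tau_gt0.
- exact: continuous_subspaceT.
- split=> [t _||].
  + by case: (dF t).
  + exact/cvg_at_right_filter/cs.
  + exact/cvg_at_left_filter/cs.
- by move=> t _; rewrite derive1E; case: (dF t).
Qed.

Lemma cos_continuous_mul (k : int) : continuous (fun t : R => cos (k%:~R * t)).
Proof.
move=> t; apply: (@continuous_comp _ _ _ (fun t : R => k%:~R * t) cos).
  by apply: cvgM; [exact: cvg_cst|exact: cvg_id].
exact: continuous_cos.
Qed.

Definition geom (m : int) (n : nat) (t : R) : R[i] :=
  \sum_(l < n) character m t ^+ l.

Lemma trigp_geom m n : trigp (geom m n).
Proof.
elim: n => [|n IH].
  by apply: trigp_ext (trigp_cst 0) => t; rewrite /geom big_ord0.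
apply: trigp_ext (trigpD IH (trigp_char (m * n%:Z))) => t.
by rewrite /geom big_ord_recr /= characterX.
Qed.

Let C (m : int) (n : nat) (t : R) : R := \sum_(l < n) cos ((m * l.+1%:Z)%:~R * t).

Let C_continuous m n : continuous (C m n).
Proof.
elim: n => [|n IH] t.
  rewrite (_ : C m 0 = fun=> 0); first exact: cvg_cst.
  by apply/funext => u; rewrite /C big_ord0.
rewrite (_ : C m n.+1 = fun u => C m n u + cos ((m * n.+1%:Z)%:~R * u)).
  by apply: cvgD; [exact: IH|exact: cos_continuous_mul].
by apply/funext => u; rewrite /C big_ord_recr.
Qed.

Let mean_C m n : m != 0 -> mean (C m n) = 0.
Proof.
move=> m0; elim: n => [|n IH].
  rewrite (_ : C m 0 = fun=> 0) ?mean_cst //.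
  by apply/funext => u; rewrite /C big_ord0.
rewrite (_ : C m n.+1 = fun u => C m n u + cos ((m * n.+1%:Z)%:~R * u)); last first.
  by apply/funext => u; rewrite /C big_ord_recr.
rewrite meanD ?IH ?mean_cos ?addr0 //; first by rewrite mulf_neq0.
exact: cos_continuous_mul.
Qed.

(** The cross term 2 Re (conj S z^n) is a sum of cosines of nonzero multiples of m, whose means
    vanish. *)
Let sqn_geomS m n t : sqn (geom m n.+1 t) = sqn (geom m n t) + (1 + 2 * C m n t).
Proof.
have E : C m n t = complex.Re (cj (geom m n t) * character m t ^+ n).
  rewrite /geom cj_sum mulr_suml raddf_sum /= /C.
  rewrite (reindex_inj rev_ord_inj) /=; apply: eq_bigr => l _.
  rewrite subnSK // cjX -characterX.
  have -> : m * n%:Z = m * (n - l)%N%:Z + m * l%:Z.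
    by rewrite -mulrDr -PoszD subnK // ltnW.
  rewrite characterD.
  set z := character m t.
  have zz : z * cj z = 1.
    by rewrite -sqn_conj sqn_normc normc_character expr1n.
  rewrite -[LHS]/(complex.Re (character (m * (n - l)%N) t)).
  congr complex.Re; rewrite mulrCA (characterX m l) -/z.
  by rewrite -exprMn [cj _ * _]mulrC zz expr1n mulr1.
rewrite {}E /geom big_ord_recr /=; set S := \sum_(_ < n) _.
have : sqn (character m t ^+ n) = 1 by rewrite sqn_normc normcX normc_character !expr1n.
case: S => a b; case: (character m t ^+ n) => c d; rewrite /cj /sqn /= => E.
rewrite -[X in _ + (X + _)]E; ring.
Qed.

Lemma mean_sqn_geom m n : m != 0 -> mean (fun t => sqn (geom m n t)) = n%:R.
Proof.
move=> m0; elim: n => [|n IH].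
  rewrite (_ : (fun _ => _) = fun=> 0) ?mean_cst //.
  by apply/funext => u; rewrite /geom big_ord0 /sqn /= expr0n /= addr0.
rewrite (_ : (fun _ => _) = fun t => sqn (geom m n t) + (1 + 2 * C m n t)); last first.
  by apply/funext => u; exact: sqn_geomS.
have c2C : continuous (fun t => 2 * C m n t).
  by move=> t; apply: cvgM; [exact: cvg_cst|exact: C_continuous].
have c1C : continuous (fun t => 1 + 2 * C m n t).
  by move=> t; apply: cvgD; [exact: cvg_cst|exact: c2C].
rewrite meanD //; last exact: (trigp_continuous_sqn (trigp_geom m n)).
rewrite IH meanD //; last by move=> t; exact: cvg_cst.
rewrite mean_cst meanZ ?mean_C ?mulr0 ?addr0 ?natr1 //.
Qed.

(* If z is within 1/n of 1 then the geometric sum 1 + z + ... + z^(n-1) has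
   modulus at least n/2, while its mean square is only n. *)
Lemma tmle_near_root m n : m != 0 -> (0 < n)%N ->
  tmle [set t : R | normc (1 - character m t) < n%:R^-1] (4 / n%:R).
Proof.
move=> m0 n0; have nR : 0 < n%:R :> R by rewrite ltr0n.
have c2 : 0 < (n%:R / 2) ^+ 2 :> R by rewrite exprn_gt0 // divr_gt0.
have := tmle_chebyshev (trigp_continuous_sqn (trigp_geom m n))
  (fun t => sqn_ge0 _) c2.
rewrite mean_sqn_geom // (_ : n%:R / (n%:R / 2) ^+ 2 = 4 / n%:R); last first.
  by field; rewrite gt_eqF.
apply: tmle_sub => t _ /= zn.
set z := character m t in zn *.
have zl l : normc (1 - z ^+ l) <= l%:R / n%:R.
  elim: l => [|l IH]; first by rewrite expr0 subrr normc0 mul0r.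
  rewrite (_ : 1 - z ^+ l.+1 = (1 - z ^+ l) + z ^+ l * (1 - z)); last first.
    by rewrite exprSr; ring.
  rewrite (le_trans (normcD _ _)) // normcM normcX normc_character expr1n mul1r.
  by rewrite -natr1 mulrDl mul1r lerD // ltW.
have H : normc (n%:R - geom m n t) <= n%:R / 2.
  rewrite /geom -/z.
  have -> : n%:R - \sum_(l < n) z ^+ l = \sum_(l < n) (1 - z ^+ l).
    by rewrite sumrB sumr_const card_ord.
  rewrite (le_trans (normc_sum _ _)) //.
  have : \sum_(l < n) normc (1 - z ^+ l) <= \sum_(l < n) (l%:R / n%:R).
    by apply: ler_sum => l _; exact: zl.
  move=> /le_trans; apply; rewrite -mulr_suml ler_pdivrMr //.
  elim: n {n0 nR c2 zn zl} => [|k IH]; first by rewrite big_ord0 mul0r mul0r.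
  rewrite big_ord_recr /= -natr1 (le_trans (lerD IH (lexx _))) //.
  have : 0 <= k%:R :> R by []. 
  by move: (k%:R : R) => x x0; lra.
rewrite sqn_normc; apply: lerXn2r; rewrite ?nnegrE ?normc_ge0 ?divr_ge0 //.
have := normcD (n%:R - geom m n t) (geom m n t).
rewrite subrK => /le_trans/(_ (lerD H (lexx _))).
rewrite (_ : normc n%:R = n%:R :> R); last first.
  by rewrite -(rmorph_nat (real_complex R)) normc_real ger0_norm.
by move=> ?; lra.
Qed.

End RootsOfUnity.

(** * Truncated Poisson kernels *)

Section Kernel.
Context {R : realType}.
Implicit Types z : R[i].

Lemma geom_iota z L : (\sum_(l <- iota 1 L) z ^+ l) * (1 - z) = z - z ^+ L.+1.
Proof.
elim: L => [|L IH]; first by rewrite big_nil mul0r expr1 subrr.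
rewrite -[L.+1]addn1 iotaD big_cat /= big_seq1 mulrDl IH add1n addn1 !exprS; ring.
Qed.

Lemma normc_geom_iota z L : normc z <= 1 -> z != 1 ->
  normc (\sum_(l <- iota 1 L) z ^+ l) <= 2 / normc (1 - z).
Proof.
move=> z1 zn1; have d0 : 0 < normc (1 - z).
  rewrite lt_neqAle normc_ge0 andbT eq_sym; apply: contra zn1 => /eqP/eq0_normc.
  by move/eqP; rewrite subr_eq0 eq_sym.
rewrite ler_pdivlMr // -normcM geom_iota (le_trans (normcD _ _)) //.
rewrite normcNE normcX; apply: lerD => //.
by apply: exprn_ile1 => //; exact: normc_ge0.
Qed.

(** Cutting a block at a frequency keeps an initial range of its positive [l] and a final range of
    its negative ones, whence this bound and the next, both uniform in the cut. *)
Lemma normc_geom_prefix z L (b : pred nat) : normc z <= 1 -> z != 1 ->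
  (forall l, b l.+1 -> b l) ->
  normc (\sum_(l <- iota 1 L | b l) z ^+ l) <= 2 / normc (1 - z).
Proof.
move=> z1 zn1 bP; elim: L => [|L IH].
  by rewrite big_nil normc0 divr_ge0 // normc_ge0.
have bdown n l : (l <= n)%N -> b n -> b l.
  elim: n => [|n IHn]; first by rewrite leqn0 => /eqP ->.
  by rewrite leq_eqVlt => /predU1P[-> //|/IHn bl /bP].
have [bL|bL] := boolP (b L.+1).
  rewrite -big_filter (all_filterP _); first exact: normc_geom_iota.
  by apply/allP => l; rewrite mem_iota add1n ltnS => /andP[_ lL]; exact: bdown bL.
rewrite -[L.+1]addn1 iotaD big_cat /= big_cons big_nil add1n (negbTE bL) addr0.
exact: IH.
Qed.

(** A final range is the whole sum minus an initial range, so the constant is 2 + 2. *)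
Lemma normc_geom_suffix z L (b : pred nat) : normc z <= 1 -> z != 1 ->
  (forall l, b l -> b l.+1) ->
  normc (\sum_(l <- iota 1 L | b l) z ^+ l) <= 4 / normc (1 - z).
Proof.
move=> z1 zn1 bP.
have : \sum_(l <- iota 1 L) z ^+ l = \sum_(l <- iota 1 L | b l) z ^+ l
    + \sum_(l <- iota 1 L | ~~ b l) z ^+ l by rewrite (bigID b).
move=> /eqP; rewrite -subr_eq => /eqP <-.
rewrite (le_trans (normcD _ _)) // normcNE.
have -> : 4 / normc (1 - z) = 2 / normc (1 - z) + 2 / normc (1 - z) by rewrite -mulrDl; congr (_ / _); ring.
apply: lerD; first exact: normc_geom_iota.
apply: normc_geom_prefix => // l; exact/contra/bP.
Qed.

(** As 1 - r is at most |1 - rz|, going from rz to z costs at most another |1 - rz|. A lower bound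
    on |1 - z| thus survives damping up to a factor 2. *)
Lemma normc_sub_damped (r : R) z : 0 <= r <= 1 -> normc z = 1 ->
  normc (1 - z) <= 2 * normc (1 - r%:C * z).
Proof.
move=> /andP[r0 r1] z1.
have rz : normc (r%:C * z) = r by rewrite normcM z1 mulr1 normc_real ger0_norm.
have H1 : 1 - r <= normc (1 - r%:C * z).
  have := normcD (1 - r%:C * z) (r%:C * z); rewrite subrK normc1 rz; lra.
have H2 : normc (r%:C * z - z) = 1 - r.
  rewrite (_ : r%:C * z - z = (r - 1)%:C * z); last by rewrite rmorphB /=; ring.
  by rewrite normcM z1 mulr1 normc_real ler0_norm ?opprB // subr_le0.
have := normcD (1 - r%:C * z) (r%:C * z - z).
rewrite (_ : 1 - r%:C * z + (r%:C * z - z) = 1 - z); last by ring.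
rewrite H2; lra.
Qed.

(* Up to its tail, 1 + sum_{l >= 1} (w^l + conj w^l) is the Poisson kernel. *)
Lemma poisson_truncated z L :
  (1 + \sum_(l <- iota 1 L) z ^+ l + \sum_(l <- iota 1 L) cj z ^+ l)
    * (sqn (1 - z))%:C =
  (1 - sqn z)%:C - (z ^+ L.+1 * (1 - cj z) + cj z ^+ L.+1 * (1 - z)).
Proof.
rewrite rmorphB /= !sqn_conj cjB cj1.
have := geom_iota z L; have := geom_iota (cj z) L.
set S := \sum_(l <- _) _ ^+ l; set S' := \sum_(l <- _) _ => e1 e2.
rewrite (_ : _ * _ = (1 - z) * (1 - cj z) + S' * (1 - z) * (1 - cj z) +
  S * (1 - cj z) * (1 - z)); last by ring.
by rewrite e1 e2; ring.
Qed.

(** [poisson_truncated] is divided by |1 - w|^2, where |1 - w| >= d/2 by damping. The first term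
    comes from the Poisson kernel itself, the second from its truncation. *)
Lemma poisson_truncated_le z w L (r d : R) : w = r%:C * z ->
  0 < d -> 0 < r < 1 -> normc z = 1 -> d <= normc (1 - z) ->
  normc (1 + \sum_(l <- iota 1 L) w ^+ l + \sum_(l <- iota 1 L) cj w ^+ l)
    <= 8 * (1 - r) / d ^+ 2 + 4 * r ^+ L / d.
Proof.
move=> wE d0 /andP[r0 r1] z1 dz.
have wr : normc w = r by rewrite wE normcM z1 mulr1 normc_real ger0_norm // ltW.
have r01 : 0 <= r <= 1 by rewrite !ltW.
have h := normc_sub_damped r01 z1.
rewrite -wE in h; set D := normc (1 - w) in h.
have hD : d / 2 <= D by lra.
have D0 : 0 < D by lra.
have := congr1 (@normc R) (poisson_truncated w L); rewrite normcM => /esym e.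
have sD : sqn (1 - w) = D ^+ 2 by rewrite sqn_normc.
rewrite sD normc_real ger0_norm ?sqr_ge0 // in e.
rewrite -(ler_pM2r (exprn_gt0 2 D0)) -e.
rewrite (le_trans (normcD _ _)) // normcNE normc_real sqn_normc wr.
rewrite ger0_norm; last by rewrite subr_ge0 exprn_ile1 // ltW.
have eC : normc (1 - cj w) = D.
  by rewrite /D -(normc_conj (1 - w)) cjB cj1.
have e2 : normc (w ^+ L.+1 * (1 - cj w) + cj w ^+ L.+1 * (1 - w)) <= 2 * r ^+ L * D.
  rewrite (le_trans (normcD _ _)) // !normcM !normcX normc_conj eC -/D wr.
  have : r ^+ L.+1 * D <= r ^+ L * D.
    by rewrite ler_pM2r // exprS ler_piMl ?exprn_ge0 // ltW.
  rewrite -(mulrA 2); set x := _ * D; set y := _ * D => xy; lra.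
have h1 : 1 - r ^+ 2 <= 8 * (1 - r) / d ^+ 2 * D ^+ 2.
  rewrite mulrAC ler_pdivlMr ?exprn_gt0 //.
  have -> : 8 * (1 - r) * D ^+ 2 = (2 * (1 - r)) * (2 * D) ^+ 2 by ring.
  apply: ler_pM; [nra|exact: sqr_ge0|nra|].
  by apply: lerXn2r; rewrite ?nnegrE; lra.
have h2 : 2 * r ^+ L * D <= 4 * r ^+ L / d * D ^+ 2.
  have rL : 0 <= r ^+ L by rewrite exprn_ge0 // ltW.
  have -> : 4 * r ^+ L / d * D ^+ 2 = 2 * r ^+ L * D * (2 * D / d).
    by field; rewrite gt_eqF.
  apply: ler_peMr; first by rewrite !mulr_ge0 // ltW.
  by rewrite ler_pdivlMr //; lra.
by rewrite mulrDl lerD // (le_trans e2).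
Qed.

Lemma exists_expr_lt (r e : R) : 0 <= r < 1 -> 0 < e -> exists L, r ^+ L < e.
Proof.
move=> /andP[r0 r1] e0.
have h : `|r| < 1 by rewrite ger0_norm.
have /cvgrPdist_lt/(_ _ e0)[N _ /(_ N (leqnn N))] := cvg_expr h.
by rewrite /= sub0r normrN ger0_norm ?exprn_ge0 // => rN; exists N.
Qed.

Lemma poisson_truncated_small (d e : R) : 0 < d -> 0 < e ->
  exists (r : R) (L : nat), 0 < r < 1 /\ forall z, normc z = 1 ->
    d <= normc (1 - z) ->
    normc (1 + \sum_(l <- iota 1 L) (r%:C * z) ^+ l
             + \sum_(l <- iota 1 L) cj (r%:C * z) ^+ l) <= e.
Proof.
move=> d0 e0; have d20 : 0 < d ^+ 2 by rewrite exprn_gt0.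
(* [u] is 1 - r. The bound e d^2 / 16 makes the kernel term at most e/2, and 1/2 keeps r positive; L
   is chosen afterwards to do the same for the truncation term. *)
pose u := Num.min (1 / 2) (e * d ^+ 2 / 16).
have u0 : 0 < u by rewrite lt_min divr_gt0 //= divr_gt0 // mulr_gt0.
have u1 : u <= 1 / 2 by rewrite ge_min lexx.
have u2 : u <= e * d ^+ 2 / 16 by rewrite ge_min lexx orbT.
have r01 : 0 < 1 - u < 1 by lra.
have [L LP] : exists L, (1 - u) ^+ L < e * d / 8.
  by apply: exists_expr_lt; [lra|rewrite divr_gt0 // mulr_gt0].
exists (1 - u), L; split => // z z1 dz.
apply: le_trans (poisson_truncated_le L erefl d0 r01 z1 dz) _.
have h1 : 8 * (1 - (1 - u)) / d ^+ 2 <= e / 2 by rewrite ler_pdivrMr //; nra.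
have h2 : 4 * (1 - u) ^+ L / d <= e / 2 by rewrite ler_pdivrMr //; nra.
by rewrite (le_trans (lerD h1 h2)) // -splitr.
Qed.

End Kernel.

(** * Blocks around a square *)

Section Blocks.
Context {R : realType}.
Implicit Types (A J L N n : nat) (r d : R) (c : R[i]) (g : seq (int * R[i])) (t : R).

(* An entry (j, s, c) stands for the term of frequency A^2 + 2 A j + s, that is
   (A + j)^2 + (s - j^2). *)
Definition place A (D : seq (int * int * R[i])) : seq (int * R[i]) :=
  [seq (A%:Z ^+ 2 + 2 * A%:Z * x.1.1 + x.1.2, x.2) | x <- D].

(** The constant term of the Poisson kernel is left out and the sign reversed: where the full kernel
    is small, this sum is close to the missing term, c times the character of A^2 + s. *)
Definition kernel N L r (s : int) c : seq (int * int * R[i]) :=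
  [seq ((N * l)%N%:Z, s, - (c * r%:C ^+ l)) | l <- iota 1 L] ++
  [seq (- (N * l)%N%:Z, s, - (c * r%:C ^+ l)) | l <- iota 1 L].

(** The multiple [J.+1] given to a term exceeds every |j| used by earlier terms, so that no j occurs
    twice, as [all_patterns] requires. *)
Fixpoint kernels L r J g : seq (int * int * R[i]) :=
  if g is (s, c) :: g' then kernel J.+1 L r s c ++ kernels L r (J.+1 * L.+1) g'
  else [::].

(** The recursion runs through the same multiples as [kernels]: a point is bad when the base of one
    of the geometric sums is within d of 1. *)
Fixpoint badset A L d J g t : Prop :=
  if g is _ :: g' then
    normc (1 - character (2 * A%:Z * J.+1%:Z) t) < d \/ badset A L d (J.+1 * L.+1) g' t
  else False.

Lemma tmle_badset A L n J g : (0 < A)%N -> (0 < n)%N ->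
  tmle [set t : R | badset A L n%:R^-1 J g t] ((size g)%:R * (4 / n%:R)).
Proof.
move=> A0 n0; elim: g J => [|x g IH] J.
  by rewrite /= mul0r; apply: tmle_sub (tmle0 (lexx 0)).
have -> : (size (x :: g))%:R * (4 / n%:R) = 4 / n%:R + (size g)%:R * (4 / n%:R) :> R.
  by rewrite -[(size _)%:R]natr1 mulrDl mul1r addrC.
have m0 : 2 * A%:Z * J.+1%:Z != 0 by rewrite !mulf_neq0 // -lt0n.
exact: tmle_sub (tmleU (tmle_near_root m0 n0) (IH (J.+1 * L.+1)%N)).
Qed.

Lemma teval_place_cat A D D' t :
  teval (place A (D ++ D')) t = teval (place A D) t + teval (place A D') t.
Proof. by rewrite /place map_cat teval_cat. Qed.

Lemma freq_split A N l (s : int) t :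
  character (A%:Z ^+ 2 + 2 * A%:Z * (N * l)%N%:Z + s) t =
  character (A%:Z ^+ 2) t * character s t * character (2 * A%:Z * N%:Z) t ^+ l
  :> R[i].
Proof. by rewrite -characterX !characterD PoszM mulrA mulrAC. Qed.

Lemma freq_splitN A N l (s : int) t :
  character (A%:Z ^+ 2 + 2 * A%:Z * - (N * l)%N%:Z + s) t =
  character (A%:Z ^+ 2) t * character s t * cj (character (2 * A%:Z * N%:Z) t) ^+ l
  :> R[i].
Proof.
by rewrite character_conj -characterX !characterD PoszM mulrN mulNr mulrA mulrAC.
Qed.

Lemma teval_trunc_kernel A N L r s c (N0 : int) t :
  teval (trunc N0 (place A (kernel N L r s c))) t =
  - (character (A%:Z ^+ 2) t * (c * character s t)) *
  (\sum_(l <- iota 1 L | A%:Z ^+ 2 + 2 * A%:Z * (N * l)%N%:Z + s <= N0)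
      (r%:C * character (2 * A%:Z * N%:Z) t) ^+ l +
   \sum_(l <- iota 1 L | A%:Z ^+ 2 + 2 * A%:Z * - (N * l)%N%:Z + s <= N0)
      cj (r%:C * character (2 * A%:Z * N%:Z) t) ^+ l).
Proof.
rewrite /place map_cat trunc_cat teval_cat mulrDr /trunc /teval.
congr (_ + _); rewrite -map_comp filter_map big_map big_filter mulr_sumr.
  by apply: eq_bigr => l _; rewrite /= freq_split exprMn; ring.
apply: eq_bigr => l _; rewrite /= freq_splitN cjM cjR exprMn; ring.
Qed.

Lemma teval_kernel A N L r s c t :
  teval (place A (kernel N L r s c)) t =
  - (character (A%:Z ^+ 2) t * (c * character s t)) *
  (\sum_(l <- iota 1 L) (r%:C * character (2 * A%:Z * N%:Z) t) ^+ l +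
   \sum_(l <- iota 1 L) cj (r%:C * character (2 * A%:Z * N%:Z) t) ^+ l).
Proof.
rewrite /place map_cat teval_cat mulrDr /teval.
congr (_ + _); rewrite -map_comp big_map mulr_sumr.
  by apply: eq_bigr => l _; rewrite /= freq_split exprMn; ring.
apply: eq_bigr => l _; rewrite /= freq_splitN cjM cjR exprMn; ring.
Qed.

Definition tnorm g : R := \sum_(x <- g) normc x.2.

Lemma tnorm_ge0 g : 0 <= tnorm g.
Proof. by apply: sumr_ge0 => x _; exact: normc_ge0. Qed.

Lemma tnorm_cons x g : tnorm (x :: g) = normc x.2 + tnorm g.
Proof. by rewrite /tnorm big_cons. Qed.

(** The constants 2 and 4 for initial and final ranges add up to 6, over |1 - rz| >= d/2. Neither r,
    L nor the cut enters the bound. *)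
Lemma trunc_kernel_le A N L r d s c (N0 : int) t : 0 < r < 1 -> 0 < d ->
  d <= normc (1 - character (2 * A%:Z * N%:Z) t) ->
  normc (teval (trunc N0 (place A (kernel N L r s c))) t) <= normc c * (12 / d).
Proof.
move=> r01 d0 dz; rewrite teval_trunc_kernel.
set z := character (2 * _ * _) t in dz *.
have z1 : normc z = 1 by exact: normc_character.
have r01' : 0 <= r <= 1 by case/andP: r01 => ? ?; rewrite !ltW.
have wr : normc (r%:C * z) = r by rewrite normcM z1 mulr1 normc_real ger0_norm; case/andP: r01'.
have h : d / 2 <= normc (1 - r%:C * z) by have := normc_sub_damped r01' z1; lra.
have hw : normc (r%:C * z) <= 1 by rewrite wr; case/andP: r01'.
have wn1 : r%:C * z != 1.
  by apply/eqP => e; move: wr; rewrite e normc1; case/andP: r01 => _; lra.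
have eC : normc (1 - cj (r%:C * z)) = normc (1 - r%:C * z).
  by rewrite -(normc_conj (1 - r%:C * z)) cjB cj1.
rewrite !normcM normcNE !normcM !normc_character mul1r mulr1 ler_wpM2l ?normc_ge0 //.
rewrite (le_trans (normcD _ _)) //.
have D0 : 0 < normc (1 - r%:C * z) by lra.
have iv : (normc (1 - r%:C * z))^-1 <= 2 / d.
  by rewrite -[2 / d]invf_div lef_pV2 ?posrE ?divr_gt0.
have le1 := @normc_geom_prefix _ (r%:C * z) L (fun l => A%:Z ^+ 2 + 2 * A%:Z * (N * l)%N%:Z + s <= N0) hw wn1.
have le2 := @normc_geom_suffix _ (cj (r%:C * z)) L (fun l => A%:Z ^+ 2 + 2 * A%:Z * - (N * l)%N%:Z + s <= N0).
rewrite normc_conj eC in le2.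
have mono l : 2 * A%:Z * (N * l)%N%:Z <= 2 * A%:Z * (N * l.+1)%N%:Z.
  by rewrite ler_wpM2l // lez_nat leq_mul.
apply: le_trans (lerD (le1 _) (le2 hw _ _)) _.
- by move=> l; cbv beta; apply: le_trans; rewrite lerD2r lerD2l.
- by rewrite -(inj_eq (can_inj cjK)) cjK cj1.
- by move=> l; cbv beta; apply: le_trans; rewrite lerD2r lerD2l !mulrN lerN2.
by rewrite -mulrDl; nra.
Qed.

Lemma trunc_kernels_le A L r d J g (N0 : int) t : 0 < r < 1 -> 0 < d ->
  ~ badset A L d J g t ->
  normc (teval (trunc N0 (place A (kernels L r J g))) t) <= tnorm g * (12 / d).
Proof.
move=> r01 d0; elim: g J => [|[s c] g IH] J /=.
  by move=> _; rewrite teval_nil normc0 mulr_ge0 ?tnorm_ge0 // divr_ge0 // ltW.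
move=> /not_orP[/negP b1 b2]; rewrite -leNgt in b1.
rewrite /place map_cat trunc_cat teval_cat (le_trans (normcD _ _)) //.
rewrite tnorm_cons [leRHS]mulrDl; apply: lerD; first exact: trunc_kernel_le.
exact: IH.
Qed.

Lemma kernels_approx A L r d e J g t :
  (forall z, normc z = 1 -> d <= normc (1 - z) ->
    normc (1 + \sum_(l <- iota 1 L) (r%:C * z) ^+ l
             + \sum_(l <- iota 1 L) cj (r%:C * z) ^+ l) <= e) ->
  ~ badset A L d J g t ->
  normc (teval (place A (kernels L r J g)) t - character (A%:Z ^+ 2) t * teval g t)
   <= tnorm g * e.
Proof.
move=> He; elim: g J => [|[s c] g IH] J /=.
  by move=> _; rewrite !teval_nil mulr0 subr0 normc0 /tnorm big_nil mul0r.
move=> /not_orP[/negP b1 /IH {}IH]; rewrite -leNgt in b1.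
rewrite teval_place_cat teval_cons /= mulrDr opprD addrACA.
rewrite (le_trans (normcD _ _)) // tnorm_cons [leRHS]mulrDl; apply: lerD => //.
rewrite teval_kernel; set z := character (2 * _ * _) t in b1 *.
have := He z (normc_character _ _) b1.
set S := \sum_(_ <- _) _; set S' := \sum_(_ <- _) _ => h.
rewrite (_ : _ - _ = - (character (A%:Z ^+ 2) t * (c * character s t)) * (1 + S + S')).
  by rewrite normcM normcNE !normcM !normc_character mul1r mulr1 ler_wpM2l ?normc_ge0.
by ring.
Qed.

(** The lower bound on |j| carries the induction: the first kernel stays within [J.+1 * L.+1], which
    all later j exceed. *)
Lemma kernels_uniq L r J g :
  uniq [seq x.1.1 | x <- kernels L r J g] /\
  all (fun j : int => (J < `|j|)%N) [seq x.1.1 | x <- kernels L r J g].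
Proof.
elim: g J => [|[s c] g IH] J //=.
have [u a] := IH (J.+1 * L.+1)%N; rewrite map_cat cat_uniq all_cat u andbT.
set K := [seq x.1.1 | x <- kernel _ _ _ _ _].
have KE : K = [seq (J.+1 * l)%N%:Z | l <- iota 1 L] ++ [seq - (J.+1 * l)%N%:Z | l <- iota 1 L].
  by rewrite /K map_cat -!map_comp.
have Kin j : j \in K -> (J < `|j| <= J.+1 * L.+1)%N.
  rewrite KE mem_cat => /orP[] /mapP[l]; rewrite mem_iota add1n ltnS => /andP[l1 lL] ->.
    by rewrite absz_nat leq_mul ?(leq_trans lL) // andbT leq_pmulr.
  by rewrite abszN absz_nat leq_mul ?(leq_trans lL) // andbT leq_pmulr.
split; last first.
  apply/andP; split; first by apply/allP => j /Kin /andP[].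
  apply: sub_all a => j; apply: leq_trans.
  by rewrite ltnS (leq_trans (leqnSn J)) // leq_pmulr.
apply/andP; split.
  rewrite KE cat_uniq !map_inj_uniq ?iota_uniq ?andbT /=.
  - apply/hasPn => j /mapP[l]; rewrite mem_iota add1n ltnS => /andP[l1 lL] ->.
    by apply/mapP => -[l' _] /eqP; lia.
  - by move=> l l' /eqP; nia.
  - by move=> l l' /eqP; nia.
apply/hasPn => j /(allP a) jb; apply/negP => /Kin /andP[_].
by rewrite leqNgt jb.
Qed.

End Blocks.

(** * Blocks with small partial sums *)

Section Universal.
Context {R : realType}.
Implicit Types (Lambda : set int) (P g : seq (int * R[i])).

(* As (A + j)^2 + (s - j^2) = A^2 + 2 A j + s, this says that every finite
   pattern of shifts occurs around arbitrarily large squares. *)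
Definition all_patterns Lambda := forall D : seq (int * int),
  uniq [seq x.1 | x <- D] -> forall N0 : nat, exists2 A : nat, (N0 <= A)%N &
  forall x, x \in D -> Lambda (A%:Z ^+ 2 + 2 * A%:Z * x.1 + x.2).

Definition spectrum Lambda (N : int) P :=
  forall x, x \in P -> Lambda x.1 /\ N < x.1.

Lemma spectrum_scale Lambda N a P :
  spectrum Lambda N P -> spectrum Lambda N (tscale a P).
Proof. by move=> sP _ /mapP[x xP ->] /=; apply: sP. Qed.

Lemma spectrum_cat Lambda N P Q : spectrum Lambda N P -> spectrum Lambda N Q ->
  spectrum Lambda N (P ++ Q).
Proof. by move=> sP sQ x; rewrite mem_cat => /orP[/sP|/sQ]. Qed.

Lemma spectrum_le Lambda (M N : int) P : M <= N ->
  spectrum Lambda N P -> spectrum Lambda M P.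
Proof. by move=> MN sP x /sP[? Nx]; split => //; exact: le_lt_trans Nx. Qed.

Lemma trunc_lt Lambda (M N : int) P : spectrum Lambda N P -> M <= N -> trunc M P = [::].
Proof.
move=> sP MN; rewrite /trunc (eq_in_filter (a2 := pred0)) ?filter_pred0 //.
by move=> x /sP[_ Nx]; apply/negbTE; rewrite -ltNge (le_lt_trans MN Nx).
Qed.

Lemma trunc_ge P (N : int) : exists2 M, N <= M & forall M', M <= M' -> trunc M' P = P.
Proof.
elim: P => [|x P [M NM MP]]; first by exists N.
exists (Num.max M x.1); first by rewrite le_max NM.
move=> M'; rewrite ge_max => /andP[MM' xM'].
by rewrite /trunc /= xM' -/(trunc _ _) MP.
Qed.

Lemma exists_inv_nat_lt (x e : R) : 0 < e -> exists2 n, (0 < n)%N & x / n%:R < e.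
Proof.
move=> e0; exists (Num.bound (`|x| / e)).+1 => //.
rewrite ltr_pdivrMr // mulrC -ltr_pdivrMr //.
apply: le_lt_trans (_ : `|x| / e < _); first by rewrite ler_pM2r ?invr_gt0 ?ler_norm.
apply: lt_le_trans (archi_boundP _) _; last by rewrite ler_nat.
by rewrite divr_ge0 // ltW.
Qed.

Lemma pattern_bound (D : seq (int * int)) :
  exists B : nat, forall x, x \in D -> (`|x.1| <= B)%N /\ (`|x.2| <= B)%N.
Proof.
elim: D => [|x D [B BP]]; first by exists 0%N.
exists (B + `|x.1| + `|x.2|)%N => y; rewrite inE => /predU1P[->|/BP[h1 h2]].
  by split; [rewrite addnAC leq_addl|rewrite leq_addl].
by rewrite -addnA; split; [apply: leq_trans h1 _|apply: leq_trans h2 _]; exact: leq_addr.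
Qed.

(** Two bad sets serve the same polynomial. The one of size [eps] bounds the partial sums and fixes
    [L0]; the one of size [kappa] measures the approximation and decides the damping and length of
    the kernels. So [L0] can precede [kappa], which the walk takes far smaller than 1/L^2. *)
Lemma block Lambda g (eps : R) : all_patterns Lambda -> 0 < eps ->
  exists2 L0 : nat, (0 < L0)%N & forall L : nat, (L0 <= L)%N ->
  forall (kappa : R) (N0 : int), 0 < kappa -> exists (A : nat) P,
  [/\ spectrum Lambda N0 P,
      tmle [set t | kappa <= normc (teval P t -
        character (A%:Z ^+ 2) t * ((L%:R^-1)%:C * teval g t))] kappa
    & forall N, tmle [set t | eps <= normc (teval (trunc N P) t)] eps].
Proof.
move=> hL eps0.
have [n1 n10 n1P] := exists_inv_nat_lt ((size g)%:R * 4) eps0.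
have [L0 L00 L0P] := exists_inv_nat_lt (tnorm g * (12 / n1%:R^-1)) eps0.
exists L0 => // L L0L kappa N0 kappa0.
have L_gt0 : 0 < L%:R :> R by rewrite ltr0n (leq_trans L00).
have Li : 0 <= L%:R^-1 :> R by rewrite invr_ge0 ltW.
have [n2 n20 n2P] := exists_inv_nat_lt ((size g)%:R * 4) kappa0.
have tg := tnorm_ge0 g.
have n2i : 0 < n2%:R^-1 :> R by rewrite invr_gt0 ltr0n.
have n1i : 0 < n1%:R^-1 :> R by rewrite invr_gt0 ltr0n.
have [r [K [r01 Kr]]] := poisson_truncated_small n2i
  (divr_gt0 kappa0 (ltr_pwDr ltr01 tg)).
pose T := kernels K r 0 g.
have [B BP] := pattern_bound [seq x.1 | x <- T].
(* As |j| and |s| are at most B, this makes A + 2j >= 1, hence A^2 + 2Aj + s >= A - B > N0. *)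
have [|A A1 A2] := hL [seq x.1 | x <- T] _ (B * 3 + `|N0| + 2)%N.
  by rewrite -map_comp; have [] := kernels_uniq K r 0 g.
have A0 : (0 < A)%N by apply: leq_trans A1; rewrite addn2.
exists A, (tscale (L%:R^-1)%:C (place A T)); split.
- apply: spectrum_scale => _ /mapP[x xT ->] /=.
  have xT' : x.1 \in [seq x.1 | x <- T] by apply: map_f.
  split; first exact: A2.
  have [] := BP _ xT'; move: x.1.1 x.1.2 => j s; clear -A1 => jB sB.
  have h : 1 <= A%:Z + 2 * j by lia.
  have {}h : A%:Z <= A%:Z * (A%:Z + 2 * j) by rewrite ler_peMr.
  have -> : A%:Z ^+ 2 + 2 * A%:Z * j = A%:Z * (A%:Z + 2 * j) by ring.
  by move: (_ * _) h => y h; lia.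
- apply: tmle_trans (tmle_sub _ (tmle_badset K 0 g A0 n20)).
    by rewrite mulrA ltW.
  move=> t _ /= kt; apply: contrapT => /(kernels_approx Kr).
  rewrite -/T; move: kt; rewrite teval_scale => kt.
  set u := teval _ t in kt *; set v := teval g t in kt *.
  rewrite (_ : _ - _ = (L%:R^-1)%:C * (u - character (A%:Z ^+ 2) t * v)) in kt; last by ring.
  rewrite normcM normc_real (ger0_norm Li) in kt.
  move=> uv; have : L%:R^-1 * normc (u - character (A%:Z ^+ 2) t * v) < kappa; last first.
    by move=> /(le_lt_trans kt); rewrite ltxx.
  apply: le_lt_trans (_ : normc (u - character (A%:Z ^+ 2) t * v) < _).
    rewrite ler_piMl ?normc_ge0 // invf_le1 //.
    by rewrite ler1n (leq_trans L00).
  apply: le_lt_trans uv _.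
  rewrite mulrCA -[ltRHS]mulr1 ltr_pM2l // ltr_pdivrMr ?mul1r; lra.
- move=> N; apply: tmle_trans (tmle_sub _ (tmle_badset K 0 g A0 n10)).
    by rewrite mulrA ltW.
  move=> t _ /= et; apply: contrapT => /(trunc_kernels_le N r01 n1i).
  rewrite -/T; move: et; rewrite trunc_scale teval_scale.
  rewrite normcM normc_real (ger0_norm Li) => et.
  apply/negP; rewrite -ltNge.
  rewrite mulrC ler_pdivlMr // in et.
  apply: lt_le_trans et; rewrite ltr_pdivrMr in L0P; last by rewrite ltr0n.
  by apply: lt_le_trans L0P _; rewrite ler_pM2l // ler_nat.
Qed.

End Universal.

(** * The potential and its averages over phases *)

Section Potential.
Context {R : realType}.
Implicit Types (s H G : R) (z w : R[i]).

(** The difference of the two sides has derivative y^3 / (1 + y), which has the sign of y, so its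
    minimum is its value 0 at 0. *)
Lemma ln1D_cubic (x : R) : -1 < x -> ln (1 + x) <= x - x ^+ 2 / 2 + x ^+ 3 / 3.
Proof.
pose f (y : R) := y - y ^+ 2 / 2 + y ^+ 3 / 3 - ln (1 + y).
have f0 : f 0 = 0 by rewrite /f addr0 ln1 !expr0n /= !mul0r !subr0 addr0.
have df (y : R) : -1 < y -> is_derive y 1 f (y ^+ 3 / (1 + y)).
  move=> y1; have y1' : 0 < 1 + y by lra.
  have dl : is_derive y 1 (fun y : R => ln (1 + y)) (1 + y)^-1.
    have h := is_derive1_ln y1'.
    by apply: is_derive_eq; rewrite add0r mulr1.
  apply: is_derive_eq; rewrite /GRing.scale /= !mulr1 !mulr0.
  by field; rewrite gt_eqF.
move=> x1; rewrite -subr_ge0 -/(f x).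
have cf a b : -1 < a -> {within `[a, b], continuous f}.
  move=> a1; apply: derivable_within_continuous => y; rewrite in_itv /= => /andP[ay _].
  by have [] := df y (lt_le_trans a1 ay).
have [x0|x0|->] := ltgtP x 0; last by rewrite f0.
- have dx c : c \in `]x, 0[%R -> is_derive c 1 f (c ^+ 3 / (1 + c)).
    by rewrite in_itv /= => /andP[xc _]; exact: df (lt_trans x1 xc).
  have [c] := @MVT R f (fun c => c ^+ 3 / (1 + c)) x 0 x0 dx (cf x 0 x1).
  rewrite in_itv /= => /andP[xc c0]; rewrite f0 => e.
  have c1 : 0 < 1 + c by lra.
  have c3 : c ^+ 3 <= 0 by rewrite (exprS c 2) mulr_le0_ge0 ?sqr_ge0 // ltW.
  have h : c ^+ 3 / (1 + c) <= 0 by rewrite mulr_le0_ge0 // invr_ge0 ltW.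
  have : c ^+ 3 / (1 + c) * (0 - x) <= 0 by apply: mulr_le0_ge0 => //; lra.
  lra.
- have dx c : c \in `]0, x[%R -> is_derive c 1 f (c ^+ 3 / (1 + c)).
    by rewrite in_itv /= => /andP[xc _]; apply: df; lra.
  have [c] := @MVT R f (fun c => c ^+ 3 / (1 + c)) 0 x x0 dx (cf 0 x (ltrN10 R)).
  rewrite in_itv /= => /andP[xc c0]; rewrite f0 subr0 => ->.
  by rewrite mulr_ge0 ?divr_ge0 ?exprn_ge0 //; lra.
Qed.


(** With s = |z|^2 the Laplacian of [pot s] is 4 (3s - 5) / (1 + s)^3. The logarithm alone
    contributes -4 / (1 + s)^2; the bounded term 4 / (1 + s) outweighs this from s = 5/3 on. *)
Definition pot s : R := 4 / (1 + s) - ln (1 + s).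

(** The Taylor polynomial of degree 3 at s is a minorant on the whole half-line, however large the
    jump. Averages of the potential are thus bounded below by averages of a cubic, which are
    explicit. *)
Lemma pot_lower s s' : 0 <= s -> 0 <= s' ->
  pot s - ((1 + s)^-1 + 4 / (1 + s) ^+ 2) * (s' - s)
    + ((1 + s) ^- 2 / 2 + 4 / (1 + s) ^+ 3) * (s' - s) ^+ 2
    - ((1 + s) ^- 3 / 3 + 4 / (1 + s) ^+ 4) * (s' - s) ^+ 3 <= pot s'.
Proof.
move=> s0 s0'; set a := 1 + s; set D := s' - s; have a0 : 0 < a by rewrite /a; lra.
have b0 : 0 < a + D by rewrite /a /D; lra.
have bE : 1 + s' = a + D by rewrite /a /D; ring.
have x1 : -1 < D / a by rewrite ltr_pdivlMr //; lra.
have lnE : ln (a + D) = ln a + ln (1 + D / a).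
  rewrite -lnM ?posrE //; last by lra.
  by congr ln; field; rewrite gt_eqF.
have := ln1D_cubic x1.
rewrite /pot bE -/a lnE => hl.
have hq : 4 * (a^-1 - D / a ^+ 2 + D ^+ 2 / a ^+ 3 - D ^+ 3 / a ^+ 4) <= 4 / (a + D).
  rewrite ler_pM2l // -subr_ge0.
  rewrite (_ : _ - _ = D ^+ 4 / (a ^+ 4 * (a + D))); last by field; rewrite !gt_eqF.
  have a4 : 0 < a ^+ 4 by rewrite exprn_gt0.
  have D4 : 0 <= D ^+ 4 by rewrite exprn_even_ge0.
  by rewrite divr_ge0 // mulr_ge0 // ltW.
have e : (a ^- 2 / 2 + 4 / a ^+ 3) * D ^+ 2 = (D / a) ^+ 2 / 2 + 4 * (D ^+ 2 / a ^+ 3).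
  by field; rewrite gt_eqF.
have e' : (a ^- 3 / 3 + 4 / a ^+ 4) * D ^+ 3 = (D / a) ^+ 3 / 3 + 4 * (D ^+ 3 / a ^+ 4).
  by field; rewrite gt_eqF.
have e'' : (a^-1 + 4 / a ^+ 2) * D = D / a + 4 * (D / a ^+ 2) by field; rewrite gt_eqF.
rewrite e e' e''; lra.
Qed.

(** The remainders of first order carry a factor 1 / (1 + s'), which is at most 1; dropping it
    leaves a quadratic majorant. *)
Lemma pot_upper s s' : 0 <= s -> 0 <= s' ->
  pot s' <= pot s - ((1 + s)^-1 + 4 / (1 + s) ^+ 2) * (s' - s)
    + ((1 + s)^-1 + 4 / (1 + s) ^+ 2) * (s' - s) ^+ 2.
Proof.
move=> s0 s0'; set a := 1 + s; set D := s' - s; have a0 : 0 < a by rewrite /a; lra.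
have b1 : 1 <= a + D by rewrite /a /D; lra.
have b0 : 0 < a + D by lra.
have bE : 1 + s' = a + D by rewrite /a /D; ring.
have ab0 : 0 < a / (a + D) by rewrite divr_gt0.
have lnE : ln a = ln (a + D) + ln (1 + (a / (a + D) - 1)).
  rewrite -lnM ?posrE //; last by lra.
  by congr ln; field; rewrite gt_eqF.
have hl : ln (1 + (a / (a + D) - 1)) <= a / (a + D) - 1 by apply: le_ln1Dx; lra.
rewrite /pot bE -/a lnE.
have bi : (a + D)^-1 <= 1 by rewrite invf_le1.
have D2 : 0 <= D ^+ 2 by rewrite sqr_ge0.
have h1 : a / (a + D) - 1 <= - (D / a) + D ^+ 2 / a.
  rewrite (_ : a / (a + D) - 1 = - (D / a) + D ^+ 2 / a * (a + D)^-1); last first.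
    by field; rewrite !gt_eqF.
  by rewrite lerD2l ler_piMr // divr_ge0 // ltW.
have h2 : 4 / (a + D) <= 4 / a - 4 * (D / a ^+ 2) + 4 * (D ^+ 2 / a ^+ 2).
  rewrite (_ : 4 / (a + D) = 4 / a - 4 * (D / a ^+ 2)
    + 4 * (D ^+ 2 / a ^+ 2) * (a + D)^-1); last by field; rewrite !gt_eqF.
  by rewrite lerD2l ler_piMr // mulr_ge0 // divr_ge0 // exprn_ge0 // ltW.
have e1 : (a^-1 + 4 / a ^+ 2) * D = D / a + 4 * (D / a ^+ 2) by field; rewrite gt_eqF.
have e2 : (a^-1 + 4 / a ^+ 2) * D ^+ 2 = D ^+ 2 / a + 4 * (D ^+ 2 / a ^+ 2).
  by field; rewrite gt_eqF.
rewrite e1 e2; lra.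
Qed.

(* The average over all choices of phases 1, i, -1, -i for the steps; for cubic
   polynomials in |z|^2 it agrees with the average over all phases. *)
Fixpoint av (u : R[i] -> R) (ws : seq R[i]) z : R :=
  if ws is w :: ws' then
    (av u ws' (z + w) + av u ws' (z - w)
     + av u ws' (z + 'i%C * w) + av u ws' (z - 'i%C * w)) / 4
  else u z.

Lemma av_le u v ws z : (forall z, u z <= v z) -> av u ws z <= av v ws z.
Proof.
move=> uv; elim: ws z => [|w ws IH] z //=.
by rewrite ler_pM2r ?invr_gt0 // !lerD.
Qed.

(** G is the total variance of the walk. Without the terms in H these are the moments of |z + g|^2
    for a complex Gaussian g of variance G; the terms in H correct for steps of constant modulus. *)
Lemma av_cubic (a b c d : R) H ws z : {in ws, forall w, sqn w = H} ->
  let G := (size ws)%:R * H in let s := sqn z in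
  av (fun z => a + b * sqn z + c * sqn z ^+ 2 + d * sqn z ^+ 3) ws z =
  a + b * (s + G) + c * (s ^+ 2 + 4 * s * G + 2 * G ^+ 2 - G * H)
  + d * (s ^+ 3 + 9 * G * s ^+ 2 + 18 * s * G ^+ 2 - 9 * s * G * H
         + 6 * G ^+ 3 - 9 * G ^+ 2 * H + 4 * G * H ^+ 2).
Proof.
elim: ws z => [|w ws IH] z wsH; cbv zeta; first by rewrite /= mul0r; ring.
have wH : sqn w = H by apply: wsH; rewrite mem_head.
have ws'H : {in ws, forall w, sqn w = H}.
  by move=> w' hw; apply: wsH; rewrite inE hw orbT.
have {}IH z' := IH z' ws'H.
have -> : av (fun z => a + b * sqn z + c * sqn z ^+ 2 + d * sqn z ^+ 3) (w :: ws) z =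
  (av (fun z => a + b * sqn z + c * sqn z ^+ 2 + d * sqn z ^+ 3) ws (z + w) +
   av (fun z => a + b * sqn z + c * sqn z ^+ 2 + d * sqn z ^+ 3) ws (z - w) +
   av (fun z => a + b * sqn z + c * sqn z ^+ 2 + d * sqn z ^+ 3) ws (z + 'i%C * w) +
   av (fun z => a + b * sqn z + c * sqn z ^+ 2 + d * sqn z ^+ 3) ws (z - 'i%C * w)) / 4.
  by [].
rewrite !IH {IH wsH ws'H}.
have -> : (size (w :: ws))%:R = (size ws)%:R + 1 :> R by rewrite natr1.
set n := (size ws)%:R.
case: z w wH => [x y] [p q]; rewrite /sqn /= => <-.
by field.
Qed.

(** The term of first order in G is a quarter of the Laplacian, coming from c1 and c2; only the
    cubic coefficient c3 yields a loss of second order. *)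
Lemma av_pot_lower H ws z : {in ws, forall w, sqn w = H} -> 0 <= H ->
  forall G, G = (size ws)%:R * H -> G <= 1 ->
  forall s, s = sqn z ->
  pot s + G * (3 * s - 5) / (1 + s) ^+ 3 - 78 * G ^+ 2 / (1 + s) ^+ 2
  <= av (fun z => pot (sqn z)) ws z.
Proof.
move=> wsH H0 G GE G1 s sE.
have s0 : 0 <= s by rewrite sE sqn_ge0.
have G0 : 0 <= G by rewrite GE mulr_ge0.
(* For an empty walk G vanishes while H may not, so H <= G needs a step. *)
have GH : G = 0 \/ H <= G.
  case: ws GE {wsH} => [|w ws]; first by rewrite mul0r; left.
  by move=> ->; right; rewrite ler_peMl // ler1n.
pose a := 1 + s.
have a0 : 0 < a by rewrite /a; lra.
pose c1 := a^-1 + 4 / a ^+ 2; pose c2 := a ^- 2 / 2 + 4 / a ^+ 3.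
pose c3 := a ^- 3 / 3 + 4 / a ^+ 4.
pose k0 := pot s + c1 * s + c2 * s ^+ 2 + c3 * s ^+ 3.
pose k1 := - c1 - 2 * c2 * s - 3 * c3 * s ^+ 2.
pose k2 := c2 + 3 * c3 * s.
have low : av (fun z => k0 + k1 * sqn z + k2 * sqn z ^+ 2 + (- c3) * sqn z ^+ 3) ws z
    <= av (fun z => pot (sqn z)) ws z.
  apply: av_le => z'; apply: le_trans (pot_lower s0 (sqn_ge0 z')).
  by rewrite -/a -/c1 -/c2 -/c3 /k0 /k1 /k2 le_eqVlt; apply/orP; left; apply/eqP; ring.
apply: le_trans low; rewrite (av_cubic _ _ _ _ _ wsH) -GE -sE.
have -> : k0 + k1 * (s + G) + k2 * (s ^+ 2 + 4 * s * G + 2 * G ^+ 2 - G * H) +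
    - c3 * (s ^+ 3 + 9 * G * s ^+ 2 + 18 * s * G ^+ 2 - 9 * s * G * H +
     6 * G ^+ 3 - 9 * G ^+ 2 * H + 4 * G * H ^+ 2) =
   pot s - c1 * G + c2 * (2 * s * G + G * (2 * G - H))
   - c3 * (12 * s * G ^+ 2 + 6 * G ^+ 3 - (6 * s * G * H + G * H * (9 * G - 4 * H))).
  by rewrite /k0 /k1 /k2; ring.
have c20 : 0 <= c2 by rewrite /c2 addr_ge0 ?mulr_ge0 ?invr_ge0 ?exprn_ge0 // ltW.
have c30 : 0 <= c3 by rewrite /c3 addr_ge0 ?mulr_ge0 ?invr_ge0 ?exprn_ge0 // ltW.
have h2 : c2 * (2 * s * G) <= c2 * (2 * s * G + G * (2 * G - H)).
  by rewrite ler_wpM2l // lerDl; case: GH => [->|GH]; rewrite ?mul0r // mulr_ge0 //; lra.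
have h3 : c3 * (12 * s * G ^+ 2 + 6 * G ^+ 3 - (6 * s * G * H + G * H * (9 * G - 4 * H)))
    <= c3 * (12 * s * G ^+ 2 + 6 * G ^+ 3).
  rewrite ler_wpM2l // gerBl; apply: addr_ge0; first by rewrite !mulr_ge0.
  by case: GH => [->|GH]; rewrite ?mul0r // !mulr_ge0 //; lra.
(* The constant is 78 = (13/3) 18, from c3 <= (13/3) / a^3 and 12 s G^2 + 6 G^3 <= 18 a G^2. *)
have h4 : c3 * (12 * s * G ^+ 2 + 6 * G ^+ 3) <= 78 * G ^+ 2 / a ^+ 2.
  have e : 78 * G ^+ 2 / a ^+ 2 = (13 / 3 * a ^- 3) * (18 * a * G ^+ 2).
    by field; rewrite gt_eqF.
  rewrite e; apply: ler_pM => //.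
  - by rewrite addr_ge0 // !mulr_ge0 // exprn_ge0.
  - have -> : c3 = (1 / 3 + 4 * a^-1) * a ^- 3 by rewrite /c3; field; rewrite gt_eqF.
    apply: ler_wpM2r; first by rewrite invr_ge0 exprn_ge0 // ltW.
    have : a^-1 <= 1 by rewrite invf_le1 // /a; lra.
    lra.
  - have G2 : 0 <= G ^+ 2 by rewrite sqr_ge0.
    have -> : G ^+ 3 = G * G ^+ 2 by rewrite exprS.
    rewrite /a; nra.
have e1 : G * (3 * s - 5) / a ^+ 3 = - (c1 * G) + c2 * (2 * s * G).
  by rewrite /c1 /c2 /a; field; rewrite gt_eqF.
rewrite -/a e1; lra.
Qed.

(** For s >= 2 the factor (3s - 5) / (1 + s) is at least 1/3, and G <= 1/1000 keeps the error below
    0.078 G / (1 + s)^2, which leaves 1/4. For s < 2 that factor is at least -5, whence the loss 6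
    G. *)
Lemma av_pot_ge H ws z : {in ws, forall w, sqn w = H} -> 0 <= H ->
  forall G, G = (size ws)%:R * H -> G <= 1 / 1000 ->
  pot (sqn z) + G / (1 + sqn z) ^+ 2 / 4 - (if sqn z < 2 then 6 * G else 0)
  <= av (fun z => pot (sqn z)) ws z.
Proof.
move=> wsH H0 G GE G1.
have G0 : 0 <= G by rewrite GE mulr_ge0.
apply: le_trans (av_pot_lower wsH H0 GE _ erefl); last by lra.
have s0 := sqn_ge0 z; move: (sqn z) s0 => s s0.
set a := 1 + s; have a1 : 1 <= a by rewrite /a; lra.
have a0 : 0 < a by lra.
have ai : 0 < a ^- 2 by rewrite invr_gt0 exprn_gt0.
have ai1 : a ^- 2 <= 1 by rewrite invf_le1 ?exprn_gt0 // exprn_ege1.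
have Ga : 0 <= G * a ^- 2 by rewrite mulr_ge0 // ltW.
have Ga1 : G * a ^- 2 <= G by rewrite ler_piMr.
have GGa : G ^+ 2 / a ^+ 2 <= (1 / 1000) * (G * a ^- 2).
  by rewrite expr2 -mulrA ler_wpM2r.
have e : G * (3 * s - 5) / a ^+ 3 = (G * a ^- 2) * ((3 * s - 5) / a).
  by rewrite /a; field; rewrite gt_eqF.
rewrite -!addrA lerD2l e; case: ifPn => [s2|]; last rewrite -leNgt => s2.
  have : - 5 <= (3 * s - 5) / a by rewrite ler_pdivlMr // /a; nra.
  move: (_ / a) => y y5.
  have : - (5 * G) <= (G * a ^- 2) * y by nra.
  rewrite -(mulrA 78); lra.
have : 1 / 3 <= (3 * s - 5) / a by rewrite ler_pdivlMr // /a; lra.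
move: ((3 * s - 5) / a) => y y5.
have : 1 / 3 * (G * a ^- 2) <= (G * a ^- 2) * y by rewrite mulrC ler_wpM2l.
rewrite -(mulrA 78); lra.
Qed.

(** Bounds what the phases still free can add, so that the mean potential midway through a walk is
    nearly as large as its average over the remaining phases. *)
Lemma av_pot_le H ws z : {in ws, forall w, sqn w = H} -> 0 <= H ->
  (size ws)%:R * H <= 1 ->
  av (fun z => pot (sqn z)) ws z <= pot (sqn z) + 20 * ((size ws)%:R * H).
Proof.
move=> wsH H0 G1; set G := _ * H; set s := sqn z.
have s0 : 0 <= s by exact: sqn_ge0.
have G0 : 0 <= G by rewrite mulr_ge0.
pose a := 1 + s.
have a0 : 0 < a by rewrite /a; lra.
pose c1 := a^-1 + 4 / a ^+ 2.
have low : av (fun z => pot (sqn z)) ws z <=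
   av (fun z => (pot s + c1 * s + c1 * s ^+ 2) + (- c1 - 2 * c1 * s) * sqn z
     + c1 * sqn z ^+ 2 + 0 * sqn z ^+ 3) ws z.
  apply: av_le => z'; apply: le_trans (pot_upper s0 (sqn_ge0 z')) _.
  by rewrite -/a -/c1 le_eqVlt; apply/orP; left; apply/eqP; ring.
apply: le_trans low _; rewrite (av_cubic _ _ _ _ _ wsH) -/G -/s.
have c10 : 0 <= c1 by rewrite /c1 addr_ge0 ?mulr_ge0 ?invr_ge0 ?exprn_ge0 // ltW.
have ai : a^-1 <= 1 by rewrite invf_le1 // /a; lra.
have ai0 : 0 < a^-1 by rewrite invr_gt0.
have h : c1 * (2 * s + 2 * G) <= 20.
  have -> : c1 = (1 + 4 * a^-1) * a^-1 by rewrite /c1; field; rewrite gt_eqF.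
  have -> : 20 = (1 + 4) * (a^-1 * (4 * a)) by field; rewrite gt_eqF.
  rewrite -mulrA; apply: ler_pM; [by lra|by apply: mulr_ge0; lra|by lra|].
  by rewrite ler_pM2l // /a -/G in G1 *; lra.
have h2 : 0 <= c1 * G by rewrite mulr_ge0.
have h3 : c1 * (2 * s + 2 * G) * G <= 20 * G by rewrite ler_wpM2r.
have h4 : 0 <= c1 * (G * H) by rewrite !mulr_ge0.
rewrite (_ : _ + _ = pot s - c1 * G + c1 * (2 * s + 2 * G) * G - c1 * (G * H)); last by ring.
lra.
Qed.

End Potential.

(** * The walk *)

Section Walk.
Context {R : realType}.
Implicit Types (Lambda : set int) (P g : seq (int * R[i])) (N : int).

Definition upot (z : R[i]) : R := pot (sqn z).

Lemma pot_continuous (s : R) : 0 <= s -> {for s, continuous pot}.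
Proof.
move=> s0; have s1 : 0 < 1 + s by lra.
have c1 : (1 + x) @[x --> s] --> 1 + s by apply: cvgD; [exact: cvg_cst|exact: cvg_id].
apply: cvgB.
  apply: cvgM; first exact: cvg_cst.
  by apply: cvgV => //; rewrite gt_eqF.
exact: (cvg_comp _ _ c1 (continuous_ln s1)).
Qed.

Lemma upot_continuous f : trigp f -> continuous (fun t => upot (f t)).
Proof.
move=> /trigp_continuous_sqn cf t.
apply: (@continuous_comp _ _ _ (fun t => sqn (f t)) pot t); first exact: cf.
by apply: pot_continuous; exact: sqn_ge0.
Qed.

Lemma av_continuous (ws : seq (R -> R[i])) f :
  (forall w, List.In w ws -> trigp w) -> trigp f ->
  continuous (fun t => av upot [seq w t | w <- ws] (f t)).
Proof.
elim: ws f => [|w ws IH] f tws tf; first exact: upot_continuous.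
have tw : trigp w by apply: tws; left.
have {}IH := IH _ (fun w' h => tws w' (or_intror h)).
move=> t; apply: cvgM; last exact: cvg_cst.
apply: cvgD; last exact: (IH _ (trigpB tf (trigpZ 'i%C tw))).
apply: cvgD; last exact: (IH _ (trigpD tf (trigpZ 'i%C tw))).
apply: cvgD; last exact: (IH _ (trigpB tf tw)).
exact: (IH _ (trigpD tf tw)).
Qed.

(** One phase serves all t, since it multiplies a whole block. Hence only the mean over t is
    controlled: it is the average of the means for the four phases, one of which is at least as
    large. *)
Lemma av_choice w ws f : (forall w', List.In w' (w :: ws) -> trigp w') -> trigp f ->
  exists2 a : R[i], normc a = 1 &
  mean (fun t => av upot [seq w t | w <- w :: ws] (f t)) <=
  mean (fun t => av upot [seq w t | w <- ws] (f t + a * w t)).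
Proof.
move=> tws tf; have tw : trigp w by apply: tws; left.
pose F (a : R[i]) t := av upot [seq w t | w <- ws] (f t + a * w t).
have cF a : continuous (F a).
  apply: av_continuous; first by move=> w' h; apply: tws; right.
  by apply: trigpD => //; exact: trigpZ.
have E : mean (fun t => av upot [seq w t | w <- w :: ws] (f t)) =
    (mean (F 1) + mean (F (-1)) + mean (F 'i%C) + mean (F (- 'i%C))) / 4.
  have c2 : continuous (fun t => F 1 t + F (-1) t).
    by move=> t; apply: cvgD; exact: cF.
  have c3 : continuous (fun t => F 1 t + F (-1) t + F 'i%C t).
    by move=> t; apply: cvgD; [exact: c2|exact: cF].
  have c4 : continuous (fun t => F 1 t + F (-1) t + F 'i%C t + F (- 'i%C) t).
    by move=> t; apply: cvgD; [exact: c3|exact: cF].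
  rewrite -!meanD // mulrC -meanZ //; congr mean; apply/funext => t.
  by rewrite /F /= mul1r mulN1r mulNr mulrC.
apply: contrapT => /forall2NP H.
have n1 : normc (1 : R[i]) = 1 by exact: normc1.
have ni : normc ('i%C : R[i]) = 1 by rewrite /normc expr0n /= expr1n add0r sqrtr1.
have h a : normc a = 1 -> mean (F a) < mean (fun t => av upot [seq w t | w <- w :: ws] (f t)).
  by move=> a1; case: (H a) => // /negP; rewrite -ltNge.
have := h 1 n1; have := h (-1); rewrite normcNE => /(_ n1).
have := h 'i%C ni; have := h (- 'i%C); rewrite normcNE => /(_ ni).
move: E; move: (mean (F 1)) (mean (F (-1))) (mean (F 'i%C)) (mean (F (- 'i%C))).
by move: (mean _) => m a b c d ->; clear; lra.
Qed.

Context (Lambda : set int) (v : R -> R[i]) (kappa eps : R).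
Context (tv : trigp v) (kappa0 : 0 < kappa) (eps0 : 0 < eps).

Definition step (A : nat) t : R[i] := character (A%:Z ^+ 2) t * v t.

Definition good_block N (b : nat * seq (int * R[i])) :=
  [/\ spectrum Lambda N b.2,
      tmle [set t | kappa <= normc (teval b.2 t - step b.1 t)] kappa
    & forall M, tmle [set t | eps <= normc (teval (trunc M b.2) t)] eps].

(** Blocks occupy successive frequency ranges, so a truncation cuts at most one of them. *)
Fixpoint chain N (bs : seq (nat * seq (int * R[i]))) : Prop :=
  if bs is b :: bs' then
    good_block N b /\ exists N', [/\ N <= N',
      forall M, N' <= M -> trunc M b.2 = b.2 & chain N' bs']
  else True.

Lemma chain_exists n N : (forall N, exists b, good_block N b) ->
  exists bs, size bs = n /\ chain N bs.
Proof.
move=> H; elim: n N => [|n IH] N; first by exists [::].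
have [b bP] := H N; have [N' NN' N'P] := trunc_ge b.2 N.
have [bs [sz cbs]] := IH N'; exists (b :: bs); split; first by rewrite /= sz.
by split => //; exists N'.
Qed.

Definition steps (bs : seq (nat * seq (int * R[i]))) := [seq step b.1 | b <- bs].

Lemma trigp_steps bs w : List.In w (steps bs) -> trigp w.
Proof.
elim: bs => [//|b bs IH] /= [<-|/IH //].
by apply: trigpM => //; exact: trigp_char.
Qed.

(** The method of conditional expectations: averaged over the phases still free, the mean potential
    never drops as phases get fixed. [h] and [u] are positions of the walk with the ideal steps, and
    the errors of the blocks are collected in [e], whose extra [kappa] keeps it positive for an
    empty chain. *)
Lemma walk bs N f : chain N bs -> trigp f ->
  let J := mean (fun t => av upot [seq w t | w <- steps bs] (f t)) in
  let e := (size bs).+1%:R * kappa in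
  exists P h, [/\ spectrum Lambda N P, trigp h,
    J <= mean (fun t => upot (h t)),
    tmle [set t | e <= normc (f t - teval P t - h t)] e
  & forall M, exists k u, [/\ trigp u,
      J <= mean (fun t => av upot [seq w t | w <- steps (drop k bs)] (u t))
    & tmle [set t | eps + e <= normc (f t - teval (trunc M P) t - u t)] (eps + e)]].
Proof.
elim: bs N f => [|b bs IH] N f cb tf; cbv zeta.
  exists [::], f; split => //.
    rewrite mul1r; apply: tmle_sub (tmle0 (ltW kappa0)) => t _ /=.
    by rewrite teval_nil subr0 subrr normc0 leNgt kappa0.
  move=> M; exists 0%N, f; split => //.
  have h : 0 < eps + 1 * kappa by rewrite mul1r addr_gt0.
  apply: tmle_sub (tmle0 (ltW h)) => t _ /=.
  by rewrite teval_nil subr0 subrr normc0 leNgt h.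
have [[sb ab pb] [N' [NN' N'P cbs]]] := cb.
have [a a1 aJ] := av_choice (@trigp_steps (b :: bs)) tf.
have tf' : trigp (fun t => f t + a * step b.1 t).
  by apply: trigpD => //; apply: trigpZ; apply: (@trigp_steps (b :: bs)); left.
have [P [h [sP th Jh eP partP]]] := IH N' _ cbs tf'.
set e := (size bs).+1%:R * kappa in eP partP.
have -> : (size (b :: bs)).+1%:R * kappa = kappa + e by rewrite -natr1 mulrDl mul1r addrC.
(* The residual is f minus the polynomial, so adding the step [a] to it means putting the block with
   coefficient -a. *)
exists (tscale (- a) b.2 ++ P), h; split => //.
- apply: spectrum_cat; first exact: spectrum_scale.
  exact: spectrum_le sP.
- exact: le_trans aJ Jh.
- apply: tmle_sub (tmleU ab eP) => t _ /= H.
  apply: contrapT => /not_orP[/negP h1 /negP h2]; rewrite -!ltNge in h1 h2.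
  move: H; rewrite leNgt => /negP; apply.
  rewrite teval_cat teval_scale (_ : _ - _ - _ = a * (teval b.2 t - step b.1 t) +
    (f t + a * step b.1 t - teval P t - h t)); last by ring.
  by rewrite (le_lt_trans (normcD _ _)) // normcM a1 mul1r ltrD.
(* A cut inside the first block leaves the walk at its start, up to a partial sum of that block. *)
- move=> M; have [NM|MN] := leP N' M; last first.
    exists 0%N, f; split => //.
    have kpos : 0 <= kappa + e by rewrite addr_ge0 ?mulr_ge0 // ltW.
    apply: tmle_trans (tmle_sub _ (pb M)); first by rewrite lerDl.
    move=> t _ /=; rewrite trunc_cat (trunc_lt sP (ltW MN)) cats0 trunc_scale.
    rewrite teval_scale addrAC subrr sub0r normcNE normcM normcNE a1 mul1r.
    by apply: le_trans; rewrite lerDl.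
  have [k [u [tu uJ eu]]] := partP M.
  exists k.+1, u; split => //; first exact: le_trans aJ uJ.
  rewrite addrCA; apply: tmle_sub (tmleU ab eu) => t _ /= H.
  apply: contrapT => /not_orP[/negP h1 /negP h2]; rewrite -!ltNge in h1 h2.
  move: H; rewrite leNgt => /negP; apply.
  rewrite trunc_cat trunc_scale N'P // teval_cat teval_scale.
  rewrite (_ : _ - _ - _ = a * (teval b.2 t - step b.1 t) +
    (f t + a * step b.1 t - teval (trunc M P) t - u t)); last by ring.
  by rewrite (le_lt_trans (normcD _ _)) // normcM a1 mul1r ltrD.
Qed.

End Walk.

(** * Polynomials close to a step function *)

Section Threshold.
Context {R : realType}.
Implicit Types (x d : R).

(** The cubic fixes 0, 1/2 and 1, and its iterates on [0, 1] push points below 1/2 to 0 and, by the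
    symmetry x -> 1 - x, points above 1/2 to 1. *)
Let hs x := 3 * x ^+ 2 - 2 * x ^+ 3.

Let hs_01 x : 0 <= x <= 1 -> 0 <= hs x <= 1.
Proof.
move=> /andP[x0 x1]; have e : hs x = x ^+ 2 * (3 - 2 * x) by rewrite /hs; ring.
have e' : 1 - hs x = (1 - x) ^+ 2 * (1 + 2 * x) by rewrite /hs; ring.
have h : 0 <= x ^+ 2 * (3 - 2 * x) by rewrite mulr_ge0 ?sqr_ge0 //; lra.
have h' : 0 <= (1 - x) ^+ 2 * (1 + 2 * x) by rewrite mulr_ge0 ?sqr_ge0 //; lra.
by apply/andP; split; lra.
Qed.

Let hs_low x d : 0 < d -> 0 <= x <= 1 / 2 - d -> hs x <= (1 - d) * x.
Proof.
move=> d0 /andP[x0 x1]; have e : hs x = (3 * x - 2 * x ^+ 2) * x by rewrite /hs; ring.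
by rewrite e ler_wpM2r //; nra.
Qed.

Let iter_01 n x : 0 <= x <= 1 -> 0 <= iter n hs x <= 1.
Proof. by move=> x01; elim: n => [//|n IH]; rewrite iterS; exact: hs_01. Qed.

Let iter_low n x d : 0 < d -> 0 <= x <= 1 / 2 - d -> iter n hs x <= (1 - d) ^+ n.
Proof.
move=> d0 /andP[x0 x1].
suff [] : iter n hs x <= (1 - d) ^+ n * x /\ 0 <= iter n hs x <= 1 / 2 - d.
  move=> /le_trans h _; apply: h; rewrite ler_piMr ?exprn_ge0 //; lra.
elim: n => [|n [IH1 IH2]]; first by rewrite expr0 mul1r lexx x0 x1.
have h := hs_low d0 IH2; case/andP: IH2 => i0 i1.
have /hs_01/andP[h0 _] : 0 <= iter n hs x <= 1 by rewrite i0; lra.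
rewrite iterS exprS -mulrA; split; last by rewrite h0; nra.
by rewrite (le_trans h) // ler_wpM2l //; lra.
Qed.

Let hs_sym x : hs (1 - x) = 1 - hs x.
Proof. by rewrite /hs; ring. Qed.

Let iter_sym n x : iter n hs (1 - x) = 1 - iter n hs x.
Proof. by elim: n => [//|n IH]; rewrite !iterS IH hs_sym. Qed.

(** Serves both to switch off the steps of the walk where the residual is small and to approximate
    indicators of arcs: a polynomial in a real trigonometric polynomial is again one. *)
Lemma threshold_poly (theta B d kappa : R) : 0 < d -> 0 < kappa -> 0 < B ->
  `|theta| <= B -> exists q : {poly R}, forall u, `|u| <= B ->
    [/\ 0 <= q.[u] <= 1, (u <= theta - d -> q.[u] <= kappa)
      & (theta + d <= u -> 1 - kappa <= q.[u])].
Proof.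
move=> d0 k0 B0 tB.
pose d' := Num.min (d / (4 * B)) (1 / 2).
have B4 : 0 < 4 * B by rewrite mulr_gt0.
have d'0 : 0 < d' by rewrite lt_min divr_gt0 //=.
have d'2 : d' <= 1 / 2 by rewrite ge_min lexx orbT.
have d'1 : d' <= d / (4 * B) by rewrite ge_min lexx.
have [n nP] : exists n, (1 - d') ^+ n < kappa.
  by apply: exists_expr_lt => //; lra.
(* Sends theta to 1/2 and, as |u - theta| <= 2B, the range of u into [0, 1]. *)
pose aff : {poly R} := (4 * B)^-1 *: 'X + (1 / 2 - theta / (4 * B))%:P.
pose q := iter n (fun p : {poly R} => 3 *: p ^+ 2 - 2 *: p ^+ 3) aff.
have qE u : q.[u] = iter n hs (1 / 2 + (u - theta) / (4 * B)).
  have affE : aff.[u] = 1 / 2 + (u - theta) / (4 * B).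
    by rewrite /aff hornerD hornerZ hornerX hornerC; field; rewrite gt_eqF.
  rewrite -affE /q; elim: n {nP q} => [//|n IH].
  by rewrite !iterS -IH /hs hornerD hornerN !hornerZ !horner_exp.
exists q => u uB; rewrite qE.
have : `|u - theta| <= 2 * B by rewrite (le_trans (ler_normB _ _)) //; lra.
rewrite ler_norml => /andP[u1 u2].
set x := 1 / 2 + _.
have x01 : 0 <= x <= 1.
  have : - (1 / 2) <= (u - theta) / (4 * B) by rewrite ler_pdivlMr //; lra.
  have : (u - theta) / (4 * B) <= 1 / 2 by rewrite ler_pdivrMr //; lra.
  by rewrite /x => *; apply/andP; split; lra.
split; first exact: iter_01.
  move=> ut; rewrite (le_trans _ (ltW nP)) //; apply: iter_low => //.
  case/andP: x01 => -> _ /=; have : (u - theta) / (4 * B) <= - (d / (4 * B)).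
    by rewrite -mulNr ler_pM2r ?invr_gt0 //; lra.
  by rewrite /x; lra.
move=> ut; have -> : x = 1 - (1 - x) by ring.
rewrite iter_sym lerD2l lerN2 (le_trans _ (ltW nP)) //; apply: iter_low => //.
have : d / (4 * B) <= (u - theta) / (4 * B) by rewrite ler_pM2r ?invr_gt0 //; lra.
by case/andP: x01 => _ x1; rewrite subr_ge0 x1 /= /x; lra.
Qed.

End Threshold.

(** * One walk of small total variance *)

Section Macro.
Context {R : realType}.
Implicit Types (Lambda : set int) (P g : seq (int * R[i])) (N : int).

(* F below is gamma^2 / (4 (1 + |f|^2)^2) for a step of size gamma, with
   gamma >= 1/64 where |f|^2 >= 3. *)
Definition gain : R := 1 / 16384.

Lemma gain_gt0 : 0 < gain.
Proof. rewrite /gain; lra. Qed.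

Lemma macro_step Lambda (f : R -> R[i]) (kappa eps : R) N :
  all_patterns Lambda -> trigp f -> 0 < kappa -> 0 < eps ->
  exists P h (F : R -> R), [/\ spectrum Lambda N P, trigp h,
    tmle [set t | kappa <= normc (f t - teval P t - h t)] kappa,
    forall M, exists u, [/\ trigp u,
      mean (fun t => upot (f t)) - kappa - 20 / 1024 <= mean (fun t => upot (u t))
    & tmle [set t | eps <= normc (f t - teval (trunc M P) t - u t)] eps]
  & [/\ continuous F, forall t, 0 <= F t,
        forall t, 3 <= sqn (f t) -> gain / (1 + sqn (f t)) ^+ 2 <= F t
      & mean (fun t => upot (f t)) + mean F - kappa <= mean (fun t => upot (h t))]].
Proof.
move=> hL tf k0 e0.
have [B0 B00 fB] := trigp_bounded tf.
have sB t : sqn (f t) <= B0 ^+ 2 + 3.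
  have : sqn (f t) <= B0 ^+ 2 by rewrite sqn_normc lerXn2r // nnegrE normc_ge0.
  by move=> /le_trans; apply; rewrite lerDl.
pose k1 := Num.min (1 / 2) kappa.
have k10 : 0 < k1 by rewrite lt_min k0 divr_gt0.
have k12 : k1 <= 1 / 2 by rewrite ge_min lexx.
have k1k : k1 <= kappa by rewrite ge_min lexx orbT.
have B20 : 0 <= B0 ^+ 2 by rewrite sqr_ge0.
(* The switch lies between 2, from where the averaged potential gains, and 3. *)
have [q qP] : exists q : {poly R}, forall u, `|u| <= B0 ^+ 2 + 3 ->
    [/\ 0 <= q.[u] <= 1, (u <= 5 / 2 - 1 / 2 -> q.[u] <= k1)
      & (5 / 2 + 1 / 2 <= u -> 1 - k1 <= q.[u])].
  apply: threshold_poly => //; first by lra.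
  by rewrite ger0_norm; lra.
(* The factor 1/32 keeps the variance [gam t ^+ 2] at most 1/1024, below the 1/1000 required by
   [av_pot_ge]. *)
pose gam t := 1 / 32 * q.[sqn (f t)].
have qf t : [/\ 0 <= q.[sqn (f t)] <= 1, (sqn (f t) < 2 -> q.[sqn (f t)] <= k1)
      & (3 <= sqn (f t) -> 1 / 2 <= q.[sqn (f t)])].
  have [|h1 h2 h3] := qP (sqn (f t)); first by rewrite ger0_norm ?sqn_ge0.
  split => // h; first by apply: h2; lra.
  by apply: le_trans (h3 _); lra.
have tq : trigp (fun t => (q.[sqn (f t)])%:C).
  by apply: trigp_horner; exact: trigp_sqn.
have tg : trigp (fun t => (gam t)%:C).
  by apply: trigp_ext (trigpZ (1 / 32)%:C tq) => t; rewrite -rmorphM.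
have [g gE] := tg.
have [L0 L00 L0P] := @block _ _ g (eps / 2) hL (divr_gt0 e0 (ltr0Sn _ 1)).
(* As each step has modulus gam / L0, this many steps have total variance gam^2 whatever L0 is. *)
pose n := (L0 * L0)%N.
have LR : 0 < L0%:R :> R by rewrite ltr0n.
pose k2 := Num.min kappa (eps / 2).
have k20 : 0 < k2 by rewrite lt_min k0 divr_gt0.
have k2k : k2 <= kappa by rewrite ge_min lexx.
have k2e : k2 <= eps / 2 by rewrite ge_min lexx orbT.
pose k3 := k2 / n.+1%:R.
have k30 : 0 < k3 by rewrite divr_gt0.
have k3E : n.+1%:R * k3 = k2 by rewrite mulrC divfK // pnatr_eq0.
pose v t := (L0%:R^-1)%:C * teval g t.
have tv : trigp v by apply: trigpZ; exact: trigp_teval.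
have [bs [szb cb]] : exists bs, size bs = n /\ chain Lambda v k3 (eps / 2) N bs.
  apply: chain_exists => N'.
  by have [A [P [h1 h2 h3]]] := L0P L0 (leqnn _) k3 N' k30; exists (A, P).
have e20 : 0 < eps / 2 by rewrite divr_gt0.
have [P [h [sP th Jh eP partP]]] := walk tv k30 e20 cb tf.
rewrite szb k3E in eP partP.
pose G t := gam t ^+ 2.
have gam01 t : 0 <= gam t <= 1 / 32.
  by have [/andP[a b] _ _] := qf t; rewrite /gam; clear -a b; apply/andP; split; lra.
have G01 t : 0 <= G t <= 1 / 1024.
  by rewrite /G; have := gam01 t => /andP[]; move: (gam t) => x a b; clear -a b; apply/andP; split; nra.
have stepH (bs' : seq (nat * seq (int * R[i]))) t :
    {in [seq w t | w <- steps v bs'], forall w, sqn w = G t / n%:R}.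
  move=> w; rewrite /steps -map_comp => /mapP[b _ ->] /=.
  rewrite sqn_normc /step normcM normc_character mul1r /v normcM -gE !normc_real.
  rewrite exprMn !real_normK ?num_real // /G /n natrM.
  by field; rewrite gt_eqF.
have n0 : (0 < n)%N by rewrite muln_gt0 L00.
have nR : 0 < n%:R :> R by rewrite ltr0n.
have cfU := upot_continuous tf.
pose F t := G t / (1 + sqn (f t)) ^+ 2 / 4.
have cs := trigp_continuous_sqn tf.
have cF : continuous F.
  have [cg _] := trigp_continuous tg.
  move=> t; apply: cvgM; last exact: cvg_cst.
  apply: cvgM; first by rewrite /G /GRing.exp /=; apply: cvgM; exact: cg.
  apply: cvgV.
    by rewrite expf_neq0 // gt_eqF // ltr_pwDl // sqn_ge0.
  by rewrite /GRing.exp /=; apply: cvgM; apply: cvgD; [exact: cvg_cst|exact: cs|exact: cvg_cst|exact: cs].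
have F0 t : 0 <= F t.
  by rewrite /F divr_ge0 // divr_ge0 ?sqr_ge0 //; case/andP: (G01 t).
have avF t : upot (f t) + F t - kappa <= av upot [seq w t | w <- steps v bs] (f t).
  have := @av_pot_ge _ (G t / n%:R) [seq w t | w <- steps v bs] (f t) (stepH bs t).
  have Gn : 0 <= G t / n%:R by rewrite divr_ge0 //; case/andP: (G01 t).
  move=> /(_ Gn (G t)); rewrite size_map size_map szb.
  have -> : n%:R * (G t / n%:R) = G t by rewrite mulrC divfK // gt_eqF.
  have G1 : G t <= 1 / 1000 by case/andP: (G01 t) => _ h'; clear -h'; lra.
  move=> /(_ erefl G1); apply: le_trans.
  (* Where |f|^2 < 2 the possible loss 6 G is below kappa, because q <= k1 there. *)
  rewrite -/(F t) lerD2l lerN2; case: ifPn => [s2|_]; last exact: ltW.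
  have [/andP[q0 _] /(_ s2) qk _] := qf t.
  by rewrite /G /gam; clear -q0 qk k1k k12; nra.
have JF : mean (fun t => upot (f t)) + mean F - kappa <=
    mean (fun t => av upot [seq w t | w <- steps v bs] (f t)).
  have c1 : continuous (fun t => upot (f t) + F t).
    by move=> t; apply: cvgD; [exact: cfU|exact: cF].
  have c2 : continuous (fun t => upot (f t) + F t - kappa).
    by move=> t; apply: cvgB; [exact: c1|exact: cvg_cst].
  rewrite -meanD // -[X in _ - X](@mean_cst R) -mulN1r -meanZ; last first.
    by move=> t; exact: cvg_cst.
  rewrite -meanD //; last first.
    by move=> t; apply: cvgM; exact: cvg_cst.
  apply: mean_le; last by move=> t; rewrite mulN1r; exact: avF.
    by under eq_fun do rewrite mulN1r.
  by apply: av_continuous => // w; exact: trigp_steps.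
exists P, h, F; split => //.
- by apply: (tmle_trans k2k); apply: tmle_sub eP => t _ /=; exact: le_trans k2k.
- move=> M; have [k [u [tu uJ eu]]] := partP M.
  exists u; split => //.
    have : mean (fun t => av upot [seq w t | w <- steps v (drop k bs)] (u t)) <=
        mean (fun t => upot (u t) + 20 / 1024).
      apply: mean_le.
      + by apply: av_continuous => // w; exact: trigp_steps.
      + by move=> t; apply: cvgD; [exact: upot_continuous|exact: cvg_cst].
      + move=> t.
        have Gn : 0 <= G t / n%:R by rewrite divr_ge0 //; case/andP: (G01 t).
        have sz : (size [seq w t | w <- steps v (drop k bs)])%:R * (G t / n%:R) <= 1 / 1024.
          rewrite size_map size_map size_drop szb.
          apply: le_trans (_ : n%:R * (G t / n%:R) <= _).
            by rewrite ler_wpM2r // ler_nat leq_subr.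
          by rewrite mulrC divfK ?gt_eqF //; case/andP: (G01 t).
        have sz1 := le_trans sz (_ : 1 / 1024 <= 1 :> R).
        have H : av upot [seq w t | w <- steps v (drop k bs)] (u t) <= upot (u t)
          + 20 * ((size [seq w t | w <- steps v (drop k bs)])%:R * (G t / n%:R)).
          by apply: av_pot_le (stepH (drop k bs) t) Gn (sz1 _); clear; lra.
        by apply: le_trans H _; rewrite lerD2l; clear -sz; lra.
    rewrite meanD ?mean_cst; last 2 first.
    + exact: upot_continuous.
    + by move=> t; exact: cvg_cst.
    have := mean_ge0 F0; clear -uJ JF; lra.
  have e' : eps / 2 + k2 <= eps by lra.
  by apply: (tmle_trans e'); apply: tmle_sub eu => t _ /=; exact: le_trans e'.
split => //; last exact: le_trans Jh.
move=> t s3; have [_ _ /(_ s3) q2] := qf t.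
rewrite /F [leRHS]mulrAC ler_pM2r; last by rewrite invr_gt0 exprn_gt0 //; clear -s3; lra.
by rewrite /gain /G /gam; clear -q2; nra.
Qed.

End Macro.

(** * Iterating walks until the residual is mostly small *)

Section Process.
Context {R : realType}.
Implicit Types (Lambda : set int) (P g : seq (int * R[i])) (N : int).

Lemma tmle_normcD (x y z : R -> R[i]) (a b c d : R) :
  (forall t, normc (z t) <= normc (x t) + normc (y t)) ->
  tmle [set t | a <= normc (x t)] c -> tmle [set t | b <= normc (y t)] d ->
  tmle [set t | a + b <= normc (z t)] (c + d).
Proof.
move=> xyz xa yb; apply: tmle_sub (tmleU xa yb) => t _ /= H.
apply: contrapT => /not_orP[/negP h1 /negP h2]; rewrite -!ltNge in h1 h2.
by have := xyz t; lra.
Qed.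

(** Either a walk gains a fixed amount, or the mean of its F is small and Chebyshev's inequality
    shows that the residual rarely lies in the middle zone. Completed walks never lower the mean
    potential, so the loss 1 at intermediate moments covers one unfinished walk and does not grow
    with k. *)
Lemma process Lambda (f : R -> R[i]) (delta rho : R) (k : nat) N (kappa eps : R) :
  all_patterns Lambda -> trigp f -> 0 < delta -> 0 <= rho -> 0 < kappa -> 0 < eps ->
  exists P h, [/\ spectrum Lambda N P, trigp h,
    tmle [set t | kappa <= normc (f t - teval P t - h t)] kappa,
    forall M, exists u, [/\ trigp u,
      mean (fun t => upot (f t)) - 1 <= mean (fun t => upot (u t))
    & tmle [set t | eps <= normc (f t - teval (trunc M P) t - u t)] eps]
  & mean (fun t => upot (f t)) <= mean (fun t => upot (h t)) /\
    (tmle [set t | 3 <= sqn (h t) <= rho] delta \/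
     mean (fun t => upot (f t)) + k%:R * (delta * (gain / (1 + rho) ^+ 2) / 2)
       <= mean (fun t => upot (h t)))].
Proof.
move=> hL tf d0 r0; set c0 := gain / (1 + rho) ^+ 2.
have c00 : 0 < c0 by rewrite /c0 divr_gt0 ?gain_gt0 // exprn_gt0 //; lra.
set c := delta * c0 / 2; have cpos : 0 < c by rewrite /c divr_gt0 // mulr_gt0.
elim: k N kappa eps => [|k IH] N kappa eps k0 e0.
  exists [::], f; split => //.
  - apply: tmle_sub (tmle0 (ltW k0)) => t _ /=.
    by rewrite teval_nil subr0 subrr normc0 leNgt k0.
  - move=> M; exists f; split => //; first by lra.
    apply: tmle_sub (tmle0 (ltW e0)) => t _ /=.
    by rewrite teval_nil subr0 subrr normc0 leNgt e0.
  - by split => //; right; rewrite mul0r addr0.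
pose m := Num.min (kappa / 2) (eps / 2).
have m0 : 0 < m by rewrite lt_min !divr_gt0.
have mk : m <= kappa / 2 by rewrite ge_min lexx.
have me : m <= eps / 2 by rewrite ge_min lexx orbT.
have e20 : 0 < eps / 2 by rewrite divr_gt0.
have [P1 [h1 [sP1 th1 a1 part1 [J1 alt1]]]] := IH N m (eps / 2) m0 e20.
have half (E : set R) (x y : R) : x <= y -> tmle E x -> tmle E y by exact: tmle_trans.
have stop_here : tmle [set t | 3 <= sqn (h1 t) <= rho] delta ->
  exists P h, [/\ spectrum Lambda N P, trigp h,
    tmle [set t | kappa <= normc (f t - teval P t - h t)] kappa,
    forall M, exists u, [/\ trigp u,
      mean (fun t => upot (f t)) - 1 <= mean (fun t => upot (u t))
    & tmle [set t | eps <= normc (f t - teval (trunc M P) t - u t)] eps]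
  & mean (fun t => upot (f t)) <= mean (fun t => upot (h t)) /\
    (tmle [set t | 3 <= sqn (h t) <= rho] delta \/
     mean (fun t => upot (f t)) + k.+1%:R * c <= mean (fun t => upot (h t)))].
  move=> mid; exists P1, h1; split => //; last by split => //; left.
    have mk' : m <= kappa by clear -mk k0; lra.
    by apply: (half _ _ _ mk'); apply: tmle_sub a1 => t _ /=; exact: le_trans mk'.
  move=> M; have [u [tu Ju eu]] := part1 M; exists u; split => //.
  have e' : eps / 2 <= eps by clear -e0; lra.
  by apply: (half _ _ _ e'); apply: tmle_sub eu => t _ /=; exact: le_trans e'.
case: alt1 => [/stop_here //|gain1].
have [N1 NN1 N1P] := trunc_ge P1 N.
(* A mean of F above delta c0 = 2c less an error c still gains c; the bound 1/4, with the 20/1024 of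
   [macro_step], keeps the intermediate loss below 1. *)
pose m' := Num.min m (Num.min c (1 / 4)).
have m'0 : 0 < m' by rewrite lt_min m0 lt_min cpos divr_gt0.
have m'm : m' <= m by rewrite ge_min lexx.
have m'e : m' <= Num.min c (1 / 4) by rewrite ge_min lexx orbT.
have m'c : m' <= c by rewrite (le_trans m'e) // ge_min lexx.
have m'4 : m' <= 1 / 4 by rewrite (le_trans m'e) // ge_min lexx orbT.
have [P2 [h2 [F [sP2 th2 a2 part2 [cF F0 Fmid J2]]]]] := macro_step N1 hL th1 m'0 e20.
have [Fsmall|Fbig] := leP (mean F) (delta * c0).
  apply: stop_here; have := tmle_chebyshev cF F0 c00.
  have Fd : mean F / c0 <= delta by rewrite ler_pdivrMr.
  move=> /(half _ _ _ Fd); apply: tmle_sub => t _ /= /andP[s3 sr].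
  apply: le_trans (Fmid t s3); rewrite /c0 ler_pM2l ?gain_gt0 // lef_pV2 ?posrE.
  - by rewrite lerXn2r ?nnegrE //; clear -sr s3; lra.
  - by rewrite exprn_gt0 //; clear -r0; lra.
  - by rewrite exprn_gt0 //; clear -s3; lra.
exists (P1 ++ P2), h2; split => //.
- by apply: spectrum_cat => //; exact: spectrum_le sP2.
- have mm : m + m' <= kappa by clear -mk m'm; lra.
  have H : tmle [set t | m + m' <= normc (f t - teval (P1 ++ P2) t - h2 t)] (m + m').
    apply: (tmle_normcD _ a1 a2) => t.
    rewrite teval_cat; apply: le_trans (normcD _ _).
    by rewrite le_eqVlt; apply/orP; left; apply/eqP; congr normc; ring.
  by apply: (half _ _ _ mm); apply: tmle_sub H => t _ /=; exact: le_trans mm.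
- move=> M; have [MN|MN] := leP N1 M; last first.
    have [u [tu Ju eu]] := part1 M; exists u; split => //.
    have e' : eps / 2 <= eps by clear -e0; lra.
    rewrite trunc_cat (trunc_lt sP2 (ltW MN)) cats0.
    by apply: (half _ _ _ e'); apply: tmle_sub eu => t _ /=; exact: le_trans e'.
  have [u [tu Ju eu]] := part2 M; exists u; split => //; first by clear -J1 Ju m'4; lra.
  have mm : m + eps / 2 <= eps by clear -me; lra.
  have H : tmle [set t | m + eps / 2 <=
      normc (f t - teval (trunc M (P1 ++ P2)) t - u t)] (m + eps / 2).
    apply: (tmle_normcD _ a1 eu) => t.
    rewrite trunc_cat N1P // teval_cat; apply: le_trans (normcD _ _).
    by rewrite le_eqVlt; apply/orP; left; apply/eqP; congr normc; ring.
  by apply: (half _ _ _ mm); apply: tmle_sub H => t _ /=; exact: le_trans mm.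
- have cE : delta * c0 = c + c by rewrite /c -mulr2n -mulr_natl; field.
  split; first by clear -J1 J2 Fbig cE cpos m'c; lra.
  by right; rewrite -natr1 mulrDl mul1r; clear -gain1 J2 Fbig cE m'c; lra.
Qed.

Lemma upot_le (z : R[i]) : upot z <= 4 - ln (1 + sqn z).
Proof.
rewrite /upot /pot lerD2r; have := sqn_ge0 z; move: (sqn z) => s s0.
by rewrite ler_pdivrMr; lra.
Qed.

Lemma ln_sqn_continuous (f : R -> R[i]) : trigp f ->
  continuous (fun t => ln (1 + sqn (f t))).
Proof.
move=> /trigp_continuous_sqn cf t.
apply: (@continuous_comp _ _ _ (fun t => 1 + sqn (f t)) (@ln R) t).
  by apply: cvgD; [exact: cvg_cst|exact: cf].
by apply: continuous_ln; have := sqn_ge0 (f t); lra.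
Qed.

Lemma continuousZ_real (a : R) (f : R -> R) :
  continuous f -> continuous (fun t => a * f t).
Proof. by move=> cf t; apply: cvgM; [exact: cvg_cst|exact: cf]. Qed.

(** The potential is at most 4 - ln (1 + |z|^2), so a lower bound on its mean bounds the mean of
    that logarithm, to which Markov's inequality applies. *)
Lemma tmle_of_potential (u : R -> R[i]) (J tau : R) : trigp u ->
  J <= mean (fun t => upot (u t)) -> 0 < tau -> J <= 4 ->
  tmle [set t | expR ((4 - J) / tau + 1) <= sqn (u t)] tau.
Proof.
move=> tu Ju t0 J4; have cu := ln_sqn_continuous tu.
set Y := (4 - J) / tau + 1.
have Y0 : 0 < Y by rewrite /Y ltr_wpDl // divr_ge0 //; lra.
have mu : mean (fun t => ln (1 + sqn (u t))) <= 4 - J.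
  have : mean (fun t => upot (u t)) <= mean (fun t => 4 + -1 * ln (1 + sqn (u t))).
    apply: mean_le; first exact: upot_continuous.
      by move=> t; apply: cvgD; [exact: cvg_cst|exact: (continuousZ_real (a := -1) cu)].
    by move=> t; rewrite mulN1r; exact: upot_le.
  have c4 : continuous (fun _ : R => 4 : R) by move=> t; exact: cvg_cst.
  have cN : continuous (fun t => -1 * ln (1 + sqn (u t))) by exact: continuousZ_real.
  by rewrite (meanD c4 cN) mean_cst meanZ //; lra.
have l0 t : 0 <= ln (1 + sqn (u t)) by rewrite ln_ge0 // lerDl sqn_ge0.
have := tmle_chebyshev cu l0 Y0.
have le1 : mean (fun t => ln (1 + sqn (u t))) / Y <= tau.
  rewrite ler_pdivrMr // (le_trans mu) // /Y mulrDr mulr1 mulrC divfK ?gt_eqF //.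
  by lra.
move=> /(tmle_trans le1); apply: tmle_sub => t _ /= H.
rewrite -(expRK Y) ler_ln ?posrE ?expR_gt0 //; last by have := sqn_ge0 (u t); lra.
by rewrite (le_trans H) // lerDr.
Qed.

(* The bound lambda on the partial sums does not depend on delta, which allows
   gluing many copies of the approximation below. *)
Lemma approx_bounded_partial_sums Lambda (f : R -> R[i]) (tau : R) :
  all_patterns Lambda -> trigp f -> 0 < tau -> exists2 lambda : R, 0 < lambda &
  forall (delta : R) N, 0 < delta -> exists P, [/\ spectrum Lambda N P,
    tmle [set t | 3 <= normc (f t - teval P t)] delta
  & forall M, tmle [set t | lambda <= normc (f t - teval (trunc M P) t)] tau].
Proof.
move=> hL tf t0; set J := mean (fun t => upot (f t)).
have J4 (h : R -> R[i]) : trigp h -> mean (fun t => upot (h t)) <= 4.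
  move=> th; rewrite -[leRHS]mean_cst; apply: mean_le.
  - exact: upot_continuous.
  - by move=> t; exact: cvg_cst.
  - move=> t; have := upot_le (h t).
    have : 0 <= ln (1 + sqn (h t)) by rewrite ln_ge0 // lerDl sqn_ge0.
    by lra.
pose Y := (4 - (J - 1)) / (tau / 2) + 1.
have JJ : J <= 4 by exact: J4.
have Y0 : 0 < Y by rewrite /Y ltr_wpDl // divr_ge0; lra.
exists (1 + expR Y); first by rewrite addr_gt0 ?expR_gt0.
move=> delta N d0.
pose eps := Num.min 1 (tau / 2).
have e0 : 0 < eps by rewrite lt_min divr_gt0 //= ltr01.
have e1 : eps <= 1 by rewrite ge_min lexx.
have et : eps <= tau / 2 by rewrite ge_min lexx orbT.
pose kap := Num.min 1 (delta / 3).
have k0 : 0 < kap by rewrite lt_min divr_gt0 //= ltr01.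
have k1 : kap <= 1 by rewrite ge_min lexx.
have kd : kap <= delta / 3 by rewrite ge_min lexx orbT.
have d30 : 0 < delta / 3 by rewrite divr_gt0.
(* Beyond rho the final residual lives on measure at most delta/3, by [tmle_of_potential]. *)
pose rho := expR ((4 - J) / (delta / 3) + 1).
have r0 : 0 <= rho by exact: expR_ge0.
pose c := delta / 3 * (gain / (1 + rho) ^+ 2) / 2.
have c0 : 0 < c.
  by rewrite /c divr_gt0 // mulr_gt0 // divr_gt0 ?gain_gt0 // exprn_gt0 //; lra.
(* With k gains of c the mean potential would exceed its upper bound 4. *)
have [k kpos kP] := exists_inv_nat_lt ((5 - J) / c) (ltr01).
have [P [h [sP th aP partP [Jh alt]]]] := process k N hL tf d30 r0 k0 e0.
exists P; split => //.
- have mid : tmle [set t | 3 <= sqn (h t) <= rho] (delta / 3).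
    case: alt => // H; exfalso; have := J4 _ th.
    have kR : 0 < k%:R :> R by rewrite ltr0n.
    move: kP; rewrite ltr_pdivrMr // mul1r ltr_pdivrMr // -/c => kP.
    move: H; rewrite -/c -/J; lra.
  have big := tmle_of_potential th Jh d30 JJ.
  have dd : kap + (delta / 3 + delta / 3) <= delta by lra.
  apply: (tmle_trans dd); apply: tmle_sub (tmleU aP (tmleU mid big)) => t _ /= H.
  apply: contrapT => /not_orP[/negP h1 /not_orP[h2 /negP h3]].
  rewrite -!ltNge in h1 h3.
  have hs : sqn (h t) < 3.
    by rewrite ltNge; apply/negP => s3; apply: h2; rewrite s3 ltW.
  (* The radius 3 arises as 2 for the walk plus kap <= 1 for the approximation. *)
  have hn : normc (h t) < 2.
    rewrite ltNge; apply/negP => n2; move: hs; rewrite sqn_normc; nra.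
  have := normcD (f t - teval P t - h t) (h t); rewrite subrK; lra.
- move=> M; have [u [tu Ju eu]] := partP M.
  have t20 : 0 < tau / 2 by rewrite divr_gt0.
  have big := tmle_of_potential tu Ju t20 (_ : J - 1 <= 4).
  have big' : tmle [set t | expR Y <= normc (u t)] (tau / 2).
    apply: tmle_sub (big _) => [t _ /= H|]; last by lra.
    rewrite -/J -/Y (le_trans H) // sqn_normc expr2 ler_peMr ?normc_ge0 //.
    by rewrite (le_trans _ H) // -expR0 ler_expR ltW.
  have tt : eps + tau / 2 <= tau by lra.
  have H : tmle [set t | eps + expR Y <= normc (f t - teval (trunc M P) t)] (eps + tau / 2).
    by apply: (tmle_normcD _ eu big') => t; rewrite -[X in normc X <= _](subrK (u t)) normcD.
  by apply: (tmle_trans tt); apply: tmle_sub H => t _ /=; apply: le_trans; rewrite lerD2r.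
Qed.

End Process.

(** * Corrections whose partial sums are controlled by the corrected function *)

Section Correction.
Context {R : realType}.
Implicit Types (Lambda : set int) (P g : seq (int * R[i])) (N : int).

(** The complete copies add up to nearly a fraction of f, of modulus at most |f|. A truncation cuts
    only one copy, so b and tau enter once while the errors a and delta accumulate. *)
Lemma glue Lambda (f : R -> R[i]) (a b delta tau : R) (L l : nat) N :
  0 < a -> 0 < b -> 0 < delta -> 0 < tau -> (l <= L)%N -> (0 < L)%N ->
  (forall N, exists P, [/\ spectrum Lambda N P,
    tmle [set t | a <= normc ((L%:R^-1)%:C * f t - teval P t)] delta
  & forall M, tmle [set t | b <= normc ((L%:R^-1)%:C * f t - teval (trunc M P) t)] tau]) ->
  exists P, [/\ spectrum Lambda N P,
    tmle [set t | l.+1%:R * a <= normc ((l%:R / L%:R)%:C * f t - teval P t)]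
      (l.+1%:R * delta)
  & forall M, tmle [set t | normc (f t) + l.+1%:R * a + b <= normc (teval (trunc M P) t)]
      (l.+1%:R * delta + tau)].
Proof.
move=> a0 b0 d0 t0 + L0 H; elim: l N => [|l IH] N lL.
  exists [::]; split => //.
    rewrite !mul1r; apply: tmle_sub (tmle0 (ltW d0)) => t _ /=.
    by rewrite mul0r mul0r teval_nil subrr normc0 leNgt a0.
  move=> M; apply: (tmle_trans (_ : tau <= _)); first by rewrite lerDr mul1r ltW.
  apply: tmle_sub (tmle0 (ltW t0)) => t _ /=; rewrite teval_nil normc0 mul1r.
  by have := normc_ge0 (f t); lra.
have [P [sP aP bP]] := IH N (ltnW lL).
have [N1 NN1 N1P] := trunc_ge P N.
have [Q [sQ aQ bQ]] := H N1.
have SE (x : R) : l.+2%:R * x = l.+1%:R * x + x by rewrite -[l.+2%:R]natr1 mulrDl mul1r.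
exists (P ++ Q); split.
- by apply: spectrum_cat => //; exact: spectrum_le sQ.
- rewrite !SE; apply: (tmle_normcD _ aP aQ) => t.
  apply: le_trans (normcD _ _).
  rewrite teval_cat le_eqVlt; apply/orP; left; apply/eqP; congr normc.
  by rewrite -natr1 mulrDl mul1r rmorphD /=; ring.
- move=> M; have [MN|MN] := leP N1 M; last first.
    rewrite trunc_cat (trunc_lt sQ (ltW MN)) cats0.
    apply: (tmle_trans (_ : l.+1%:R * delta + tau <= _)); first by rewrite SE; lra.
    by apply: tmle_sub (bP M) => t _ /=; rewrite SE; lra.
  rewrite trunc_cat N1P //.
  apply: (tmle_trans (_ : l.+1%:R * delta + tau <= _)); first by rewrite SE; lra.
  apply: tmle_sub (tmleU aP (bQ M)) => t _ /= h; apply: contrapT => /not_orP[/negP h1 /negP h2].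
  rewrite -!ltNge in h1 h2; move: h; rewrite leNgt => /negP; apply.
  rewrite teval_cat SE.
  have E : teval P t + teval (trunc M Q) t = (l.+1%:R / L%:R)%:C * f t +
     (- ((l%:R / L%:R)%:C * f t - teval P t) +
      - ((L%:R^-1)%:C * f t - teval (trunc M Q) t)).
    by rewrite -natr1 mulrDl mul1r rmorphD /=; ring.
  rewrite E; have := normcD ((l.+1%:R / L%:R)%:C * f t)
     (- ((l%:R / L%:R)%:C * f t - teval P t) +
      - ((L%:R^-1)%:C * f t - teval (trunc M Q) t)).
  have := normcD (- ((l%:R / L%:R)%:C * f t - teval P t))
      (- ((L%:R^-1)%:C * f t - teval (trunc M Q) t)).
  rewrite !normcNE.
  have : normc ((l.+1%:R / L%:R)%:C * f t) <= normc (f t).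
    rewrite normcM normc_real ger0_norm ?divr_ge0 // ler_piMl ?normc_ge0 //.
    by rewrite ler_pdivrMr ?ltr0n // mul1r ler_nat.
  by move: h1 h2 a0; lra.
Qed.

Lemma correction Lambda (f : R -> R[i]) (eps : R) N :
  all_patterns Lambda -> trigp f -> 0 < eps -> exists P, [/\ spectrum Lambda N P,
    tmle [set t | eps <= normc (f t - teval P t)] eps
  & forall M, tmle [set t | normc (f t) + eps <= normc (teval (trunc M P) t)] eps].
Proof.
move=> hL tf e0; have [K K0 KP] := exists_inv_nat_lt 6 (divr_gt0 e0 (ltr0Sn R 1)).
have KR : 0 < K%:R :> R by rewrite ltr0n.
have e20 : 0 < eps / 2 by rewrite divr_gt0.
have [lam lam0 lamP] := approx_bounded_partial_sums hL (trigpZ K%:R%:C tf) e20.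
(* L is chosen after [lam] and [delta] after L, possible because [lam] serves every [delta]. The
   accumulated error is 3 (L+1) / (KL) <= 6/K. *)
have [L L0 LP] := exists_inv_nat_lt (lam / K%:R) e20.
have LR : 0 < L%:R :> R by rewrite ltr0n.
pose D : R := K%:R * L%:R; have D0 : 0 < D by rewrite mulr_gt0.
pose delta := eps / 2 / L.+1%:R.
have d0 : 0 < delta by rewrite divr_gt0.
have a0 : 0 < 3 / D by rewrite divr_gt0.
have b0 : 0 < lam / D by rewrite divr_gt0.
have scale (x y : R[i]) (c : R) : c / D <= normc ((L%:R^-1)%:C * x - (D^-1)%:C * y) ->
    c <= normc (K%:R%:C * x - y).
  rewrite (_ : (L%:R^-1)%:C * x - (D^-1)%:C * y = (D^-1)%:C * (K%:R%:C * x - y)); last first.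
    rewrite mulrBr mulrA -rmorphM; congr (_%:C * _ - _).
    by rewrite /D; field; rewrite !gt_eqF.
  have Di : 0 < D^-1 by rewrite invr_gt0.
  by rewrite normcM normc_real (ger0_norm (ltW Di)) mulrC ler_pM2l.
have [|P [sP aP bP]] := @glue Lambda f (3 / D) (lam / D) delta (eps / 2) L L N
  a0 b0 d0 e20 (leqnn L) L0.
  move=> N'; have [P [sP aP bP]] := lamP delta N' d0.
  exists (tscale (D^-1)%:C P); split; first exact: spectrum_scale.
    by apply: tmle_sub aP => t _ /=; rewrite teval_scale => /scale.
  move=> M; apply: tmle_sub (bP M) => t _ /=.
  by rewrite trunc_scale teval_scale => /scale.
have dE : L.+1%:R * delta = eps / 2 by rewrite mulrC divfK // pnatr_eq0.
have aE : L.+1%:R * (3 / D) <= eps / 2.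
  apply: le_trans (ltW KP); rewrite mulrA ler_pdivrMr // /D mulrA divfK ?gt_eqF //.
  have : 1 <= L%:R :> R by rewrite ler1n.
  by rewrite -natr1; lra.
have bE : lam / D <= eps / 2 by rewrite (le_trans _ (ltW LP)) // /D invfM mulrA.
rewrite dE in aP bP; exists P; split => //.
- have ee : eps / 2 <= eps by lra.
  apply: (tmle_trans ee); apply: tmle_sub aP => t _ /=.
  by rewrite divff ?gt_eqF // mul1r; lra.
- move=> M; rewrite (splitr eps); apply: tmle_sub (bP M) => t _ /=; lra.
Qed.

End Correction.

(** * Density of trigonometric polynomials in measure *)

Section Density.
Context {R : realType}.
Implicit Types (f g : R -> R[i]) (E : set R) (e : R).
Local Notation tau := (pi *+ 2 : R).
Local Notation mu := (@lebesgue_measure R).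

Definition trig_approx f := forall e, 0 < e ->
  exists2 F, trigp F & tmle [set t | e <= normc (f t - F t)] e.

Lemma trig_approx_trigp f : trigp f -> trig_approx f.
Proof.
move=> tf e e0; exists f => //; apply: tmle_sub (tmle0 (ltW e0)) => t _ /=.
by rewrite subrr normc0 leNgt e0.
Qed.

Lemma trig_approx_lim f : (forall e, 0 < e -> exists2 g, trig_approx g &
  tmle [set t | e <= normc (f t - g t)] e) -> trig_approx f.
Proof.
move=> H e e0; have e20 : 0 < e / 2 by rewrite divr_gt0.
have [g /(_ _ e20)[F tF gF] fg] := H _ e20.
exists F => //; rewrite (splitr e); apply: (tmle_normcD _ fg gF) => t.
by rewrite (le_trans _ (normcD _ _)) // addrA subrK.
Qed.

Lemma trig_approx_ext f g : (forall t, f t = g t) -> trig_approx f -> trig_approx g.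
Proof. by move=> fg; have -> : g = f by apply/funext. Qed.

Lemma trig_approxD f g : trig_approx f -> trig_approx g ->
  trig_approx (fun t => f t + g t).
Proof.
move=> fa ga e e0; have e20 : 0 < e / 2 by rewrite divr_gt0.
have [F tF fF] := fa _ e20; have [G tG gG] := ga _ e20.
exists (fun t => F t + G t); first exact: trigpD.
rewrite (splitr e); apply: (tmle_normcD _ fF gG) => t.
by rewrite opprD addrACA normcD.
Qed.

Lemma trig_approxZ (a : R[i]) f : trig_approx f -> trig_approx (fun t => a * f t).
Proof.
move=> fa e e0; have a0 := normc_ge0 a.
have d0 : 0 < e / (normc a + 1) by rewrite divr_gt0 //; lra.
have de : e / (normc a + 1) <= e by rewrite ler_pdivrMr ?ler_peMr //; lra.
have [F tF fF] := fa _ d0.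
exists (fun t => a * F t); first exact: trigpZ.
apply: (tmle_trans de); apply: tmle_sub fF => t _ /=.
rewrite -mulrBr normcM ler_pdivrMr; last by lra.
by move=> h; rewrite (le_trans h) // mulrC ler_wpM2l ?normc_ge0 //; lra.
Qed.

(** Off the exceptional set of f its approximant is bounded by 2, so the two errors enter with
    bounded factors. *)
Lemma trig_approxM f g : (forall t, normc (f t) <= 1) -> (forall t, normc (g t) <= 1) ->
  trig_approx f -> trig_approx g -> trig_approx (fun t => f t * g t).
Proof.
move=> f1 g1 fa ga e e0; pose d := Num.min 1 (e / 3).
have d0 : 0 < d by rewrite lt_min divr_gt0 // ltr01.
have d1 : d <= 1 by rewrite ge_min lexx.
have de : d <= e / 3 by rewrite ge_min lexx orbT.
have [F tF fF] := fa _ d0; have [G tG gG] := ga _ d0.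
exists (fun t => F t * G t); first exact: trigpM.
have dd : d + d <= e by lra.
apply: (tmle_trans dd); apply: tmle_sub (tmleU fF gG) => t _ /= H.
apply: contrapT => /not_orP[/negP h1 /negP h2]; rewrite -!ltNge in h1 h2.
move: H; rewrite leNgt => /negP; apply.
rewrite (_ : f t * g t - F t * G t = (f t - F t) * g t + F t * (g t - G t)); last by ring.
apply: le_lt_trans (normcD _ _) _; rewrite !normcM.
have hF : normc (F t) <= 2.
  have := normcD (F t - f t) (f t); rewrite subrK normcB => h.
  by apply: le_trans h _; have := f1 t; lra.
have p1 : normc (f t - F t) * normc (g t) <= normc (f t - F t).
  by rewrite ler_piMr ?normc_ge0.
have p2 : normc (F t) * normc (g t - G t) <= 2 * normc (g t - G t).
  by rewrite ler_wpM2r ?normc_ge0.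
lra.
Qed.

Lemma trig_approx_cos (c : R) (q : {poly R}) :
  trig_approx (fun t => (q.[cos (t - c)])%:C).
Proof.
apply/trig_approx_trigp/trigp_horner.
pose z : R[i] := cos c +i* sin c.
apply: trigp_ext (trigpD (trigpZ ((1 / 2)%:C * cj z) (trigp_char 1))
  (trigpZ ((1 / 2)%:C * z) (trigp_char (-1)))) => t.
rewrite /character /z /cj !mul1r mulN1r cosN sinN cosB.
by apply/eqP; rewrite eq_complex /=; apply/andP; split; apply/eqP; field.
Qed.

Definition indic_approx E := trig_approx (fun t => (\1_E t)%:C).

Lemma indic_approx_lim E : (forall e, 0 < e -> exists2 F, indic_approx F &
  tmle ((E `\` F) `|` (F `\` E)) e) -> indic_approx E.
Proof.
move=> H; apply: trig_approx_lim => e e0; have [F Fa EF] := H e e0.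
exists (fun t => (\1_F t)%:C) => //; apply: tmle_sub EF => t _ /= h.
have same : (\1_E t : R) = \1_F t -> False.
  by move=> EFt; move: h; rewrite EFt subrr normc0 leNgt e0.
have [tE|tE] := pselect (E t); have [tF|tF] := pselect (F t).
- by exfalso; apply: same; rewrite !indicE !mem_set.
- by left.
- by right.
- by exfalso; apply: same; rewrite !indicE !memNset.
Qed.

Lemma indic_approxI E F : indic_approx E -> indic_approx F -> indic_approx (E `&` F).
Proof.
move=> Ea Fa.
have h1 (A : set R) t : normc ((\1_A t)%:C : R[i]) <= 1.
  by rewrite normc_real indicE; case: (_ \in _); rewrite /= ?normr1 ?normr0.
apply: trig_approx_ext (trig_approxM (h1 E) (h1 F) Ea Fa) => t.
by rewrite indicI rmorphM.
Qed.

Lemma indic_approxC E : indic_approx E -> indic_approx (~` E).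
Proof.
move=> Ea; apply: trig_approx_ext
  (trig_approxD (trig_approx_trigp (trigp_cst 1)) (trig_approxZ (-1) Ea)) => t.
rewrite !indicE in_setC; case: (_ \in _) => /=; rewrite ?rmorph1 ?rmorph0; ring.
Qed.

Lemma indic_approxU E F : indic_approx E -> indic_approx F -> indic_approx (E `|` F).
Proof.
move=> Ea Fa; rewrite -[E `|` F]setCK setCU.
by apply/indic_approxC/indic_approxI; exact: indic_approxC.
Qed.

Lemma indic_approx0 : indic_approx set0.
Proof.
apply: trig_approx_ext (trig_approx_trigp (trigp_cst 0)) => t.
by rewrite indic0.
Qed.

Lemma tmle_near (x e : R) : 0 <= e -> tmle [set t | `|t - x| <= e] e.
Proof.
move=> e0; apply/tmleE.
apply: (@le_trans _ _ (mu `[x - e, x + e]%classic)).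
  by apply: mu_le => t [/= + _]; rewrite in_itv /= ler_distl.
rewrite lebesgue_measure_itv /= lte_fin; case: ifPn => _; last first.
  by rewrite lee_fin mulr_ge0 // ltW // tau_gt0.
rewrite -EFinD lee_fin; have := @pi_ge2 R; rewrite -mulr_natl.
by move: pi => p p2; nra.
Qed.

(** With centre c and half-width w, the arc is where cos (t - c) > cos w, so a threshold polynomial
    in cos (t - c) approximates its indicator. *)
Lemma indic_approx_oo (a b : R) : 0 <= a -> a < b -> b <= tau -> indic_approx `]a, b[.
Proof.
move=> a0 ab bt; pose c := (a + b) / 2; pose w := (b - a) / 2.
have tau2 : tau = 2 * pi by rewrite mulr_natl.
have p0 := @pi_gt0 R.
apply: trig_approx_lim => e e0.
pose d := Num.min (e / 4) (w / 2).
have w0 : 0 < w by rewrite /w; lra.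
have d0 : 0 < d by rewrite lt_min (divr_gt0 e0) // (divr_gt0 w0).
have d4 : d <= e / 4 by rewrite ge_min lexx.
have dw : d <= w / 2 by rewrite ge_min lexx orbT.
have wp : w <= pi by rewrite /w; lra.
pose x1 := cos (w - d) - cos w.
have x10 : 0 < x1 by rewrite /x1 subr_gt0 ltr_cos ?in_itv /=; lra.
(* When w + d > pi no point of the circle is that far from c, and any positive margin will do. *)
have [x2 x20 x2P] : exists2 x2, 0 < x2 & w + d <= pi -> x2 <= cos w - cos (w + d).
  have [h|h] := leP (w + d) pi; last by exists 1 => //; rewrite leNgt h.
  exists (cos w - cos (w + d)) => //.
  by rewrite subr_gt0 ltr_cos ?in_itv /=; lra.
pose x := Num.min x1 x2.
have x0 : 0 < x by rewrite lt_min x10.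
have xx1 : x <= x1 by rewrite ge_min lexx.
have xx2 : x <= x2 by rewrite ge_min lexx orbT.
have e20 : 0 < e / 2 by rewrite divr_gt0.
have [q qP] := threshold_poly x0 e20 ltr01 (cos_max w).
exists (fun t => (q.[cos (t - c)])%:C); first exact: trig_approx_cos.
have dd : d + d + (d + d) <= e by lra.
apply: (tmle_trans dd).
(* Neighbourhoods of 0 and tau are removed too: there a point may be near the arc across the
   identification of 0 with tau. *)
apply: tmle_sub (tmleU (tmleU (tmle_near a (ltW d0)) (tmle_near b (ltW d0)))
  (tmleU (tmle_near 0 (ltW d0)) (tmle_near tau (ltW d0)))) => t /andP[t0 t1] /= H.
apply: contrapT => /not_orP[/not_orP[/negP h1 /negP h2] /not_orP[/negP h3 /negP h4]].
rewrite -!ltNge subr0 in h1 h2 h3 h4.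
rewrite ger0_norm // in h3; rewrite ltr0_norm ?subr_lt0 // in h4.
move: H; rewrite leNgt => /negP; apply.
rewrite -rmorphB normc_real indicE.
have [q01 qlow qhigh] := qP (cos (t - c)) (cos_max _).
have cabs : cos (t - c) = cos `|t - c| by rewrite cos_norm.
have [tin|tout] := boolP (t \in `]a, b[%classic).
  move: (tin); rewrite inE /= in_itv /= => /andP[ta tb].
  rewrite gtr0_norm ?subr_gt0 // in h1; rewrite ltr0_norm ?subr_lt0 // in h2.
  have : 1 - e / 2 <= q.[cos (t - c)].
    apply: qhigh; rewrite cabs.
    have : cos (w - d) <= cos `|t - c|.
      rewrite ltW // ltr_cos ?in_itv /= ?normr_ge0 /=; first by rewrite ltr_norml /c /w; lra.
        by rewrite ltW // (lt_le_trans _ wp) // ltr_norml /c /w; lra.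
      by lra.
    by rewrite /x1 in xx1; lra.
  case/andP: q01 => q0 q1; rewrite ger0_norm ?subr_ge0 // => ?; lra.
have : q.[cos (t - c)] <= e / 2.
  apply: qlow.
  have [v [v1 v2 ->]] : exists v, [/\ w + d <= v, v <= pi & cos (t - c) = cos v].
    have far : w + d <= `|t - c|.
      move: tout; rewrite notin_setE /= in_itv /= => /negP.
      rewrite negb_and -!leNgt => /orP[ta|tb].
        rewrite ler0_norm ?subr_le0 // in h1.
        by clear -h1 ta ab; rewrite ler0_norm /c /w; lra.
      rewrite ger0_norm ?subr_ge0 // in h2.
      by clear -h2 tb ab; rewrite ger0_norm /c /w; lra.
    have [vp|vp] := leP `|t - c| pi; first by exists `|t - c|.
    exists (tau - `|t - c|); split; last first.
    - by rewrite cabs -[in RHS]cosN opprB -(cosD2pi (`|t - c| - tau)) subrK.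
    - by rewrite tau2; lra.
    - rewrite tau2 in h4 t1 *; have : `|t - c| <= 2 * pi - (w + d).
        by rewrite ler_norml /c /w; lra.
      lra.
  have h5 := x2P (le_trans v1 v2).
  have : cos v <= cos (w + d).
    move: v1; rewrite le_eqVlt => /predU1P[<- //|v1].
    by clear -v1 v2 w0 d0; rewrite ltW // ltr_cos ?in_itv /=; lra.
  by clear -h5 xx2; lra.
by case/andP: q01 => q0 q1 qe; rewrite sub0r normrN ger0_norm //; clear -qe e0; lra.
Qed.

Lemma indic_approx_oc (a b : R) : indic_approx `]a, b].
Proof.
(* Within [0, tau[ the clipped open interval differs from the given one at most at 0 and b. *)
pose F : set R := if Num.max a 0 < Num.min b tau then `]Num.max a 0, Num.min b tau[%classic else set0.
apply: indic_approx_lim => e e0; exists F.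
  rewrite /F; case: ifPn => h; last exact: indic_approx0.
  by apply: indic_approx_oo => //; [rewrite le_max lexx orbT|rewrite ge_min lexx orbT].
have e2 : 0 <= e / 2 by rewrite divr_ge0 // ltW.
rewrite (splitr e).
apply: tmle_sub (tmleU (tmle_near 0 e2) (tmle_near b e2)) => t /andP[t0 t1] /= H.
have near_self (x : R) : t = x -> `|t - x| <= e / 2 by move=> ->; rewrite subrr normr0.
have [tz|tz] := eqVneq t 0; first by left; exact: near_self.
have [tb|tb] := eqVneq t b; first by right; exact: near_self.
exfalso; have tp : 0 < t by rewrite lt_neqAle eq_sym tz.
case: H => -[].
  rewrite in_itv /= => /andP[ta]; rewrite le_eqVlt (negbTE tb) /= => tlb nF.
  have h1 : Num.max a 0 < t by rewrite gt_max ta.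
  have h2 : t < Num.min b tau by rewrite lt_min tlb.
  by apply: nF; rewrite /F (lt_trans h1 h2) /= in_itv /= h1.
rewrite /F; case: ifPn => // _; rewrite /= in_itv /= gt_max lt_min.
move=> /andP[/andP[ta _] /andP[tlb _]]; apply.
by rewrite in_itv /= ta ltW.
Qed.

Lemma indic_approx_finU (A : nat -> set R) n : (forall k, indic_approx (A k)) ->
  indic_approx (\big[setU/set0]_(k < n) A k).
Proof.
move=> hA; elim: n => [|n IH]; first by rewrite big_ord0; exact: indic_approx0.
by rewrite big_ord_recr /=; apply: indic_approxU.
Qed.

Lemma measurable_caratheodory (E : set R) :
  measurable (E : set (measurableTypeR R)) -> measurable (E : set (lebesgue_type R)).
Proof. exact: sub_caratheodory. Qed.

(** The definition of outer measure covers E by half-open intervals of nearly the same total length.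
    Finitely many of them suffice up to a small tail of the series. *)
Lemma indic_approx_measurable E : measurable (E : set (lebesgue_type R)) ->
  indic_approx E.
Proof.
move=> mE; apply: indic_approx_lim => e e0.
pose E' := E `&` `[0, tau[%classic.
have mE' : measurable (E' : set (lebesgue_type R)).
  by apply: measurableI => //; apply: measurable_caratheodory; exact: measurable_itv.
have fE' : (mu E' < +oo)%E.
  apply: (@le_lt_trans _ _ (mu `[0, tau[%classic)); first by apply: mu_le => t [].
  by rewrite lebesgue_measure_itv /= lte_fin tau_gt0 ltry.
have s0 : 0 < e / 2 by rewrite divr_gt0.
have fE'' : mu E' \is a fin_num by rewrite ge0_fin_numE.
have [_ /= [A [mA EA] <-] hA] := lb_ereal_inf_adherent s0 fE''.
pose U := \bigcup_k A k.
have muA k : mu (A k) = wlength (@idfun R) (A k).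
  exact: (measurable_mu_extE (wlength (@idfun R))).
have hA' : (\sum_(k <oo) mu (A k) < mu E' + (e / 2)%:E)%E.
  by under eq_eseriesr do rewrite muA.
have muU : (mu U <= \sum_(k <oo) mu (A k))%E.
  exact: (outer_measure_sigma_subadditive ((wlength (@idfun R))^*)%mu A).
have muUE : (mu (U `\` E') <= (e / 2)%:E)%E.
  (* Caratheodory's condition for E', tested on the cover U, turns closeness of the measures into
     smallness of the difference. *)
  have := mE' U; rewrite -setDE.
  have -> : U `&` E' = E' by apply/setIidPr.
  move=> muUE; rewrite -(@leeD2lE _ (mu E')) //.
  have <- : mu U = (mu E' + mu (U `\` E'))%E by exact: muUE.
  exact: le_trans muU (ltW hA').
have sumfin : (\sum_(k <oo) mu (A k) < +oo)%E.
  by apply: lt_le_trans hA' _; rewrite leey.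
have tail := nneseries_tail_cvg sumfin (fun k _ => measure_ge0 mu (A k)).
have [n nP] : exists n, (\sum_(n <= k <oo) mu (A k) <= (e / 2)%:E)%E.
  move/fine_cvgP : tail => [[n1 _ fin] /cvgr0Pnorm_le/(_ _ s0)[n2 _ small]].
  exists (n1 + n2)%N; have f := fin _ (leq_addr n2 n1).
  have := small _ (leq_addl n1 n2); rewrite /= => h.
  by rewrite -(fineK f) lee_fin (le_trans (ler_norm _)).
exists (\big[setU/set0]_(k < n) A k).
  apply: indic_approx_finU => k; have [[a b] _ <-] := mA k.
  exact: indic_approx_oc.
apply/tmleE; have tau1 : 1 <= tau.
  by rewrite -mulr_natl; have := @pi_ge2 R; lra.
have step : (mu (((E `\` \big[setU/set0]_(k < n) A k) `|`
    (\big[setU/set0]_(k < n) A k `\` E)) `&` `[0%R, tau[) <= e%:E)%E.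
  apply: (@le_trans _ _ (mu ((\bigcup_k A (k + n)%N) `|` (U `\` E')))).
    apply: mu_le => t [[[Et nAt]|[At nEt]] t0]; [left|right].
      have [k _ Akt] := EA t (conj Et t0).
      have nk : (n <= k)%N.
        rewrite leqNgt; apply/negP => kn; apply: nAt.
        by rewrite -bigcup_mkord; exists k.
      by exists (k - n)%N => //; rewrite subnK.
    split; last by case.
    by move: At; rewrite -bigcup_mkord => -[k _ Akt]; exists k.
  rewrite (splitr e) EFinD; apply: le_trans (muU_le _ _) _; apply: leeD => //.
  apply: le_trans nP; rewrite -nneseries_addn; last by move=> k; exact: measure_ge0.
  apply: (le_trans (outer_measure_sigma_subadditive ((wlength (@idfun R))^*)%mu (fun k => A (k + n)%N))).
  by apply: lee_nneseries => // k _; rewrite addnC.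
by apply: le_trans step _; rewrite lee_fin ler_peMl // ltW.
Qed.

(* The sum is the floor of y. *)
Lemma floor_sum (y : R) K :
  (K%:R <= y -> \sum_(j < K) (if j.+1%:R <= y then 1 else 0) = K%:R :> R) /\
  (0 <= y -> y <= K%:R ->
   y - 1 <= \sum_(j < K) (if j.+1%:R <= y then 1 else 0) <= y).
Proof.
elim: K => [|K [IH1 IH2]].
  rewrite big_ord0; split => // y0 y1; apply/andP; split; lra.
rewrite big_ord_recr /= -natr1; split => [h|y0 yK].
  by rewrite h IH1 //; lra.
have [Ky|yK'] := leP K%:R y; last first.
  have -> : (K%:R + 1 <= y) = false by apply/negbTE; rewrite -ltNge; lra.
  by rewrite addr0; apply: IH2 => //; exact: ltW.
rewrite IH1 //; case: ifPn => [|_]; first by move=> h; apply/andP; split; lra.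
by apply/andP; split; lra.
Qed.

(** Off a small set |f| < n, by continuity of the measure along decreasing sets; there f is within
    1/m of a staircase built from indicators of superlevel sets. *)
Lemma trig_approx_real (f : R -> R) :
  measurable_fun setT (f : lebesgue_type R -> measurableTypeR R) ->
  trig_approx (fun t => (f t)%:C).
Proof.
move=> mf; apply: trig_approx_lim => e e0.
have msup (c : R) : measurable ([set t | c <= f t] : set (lebesgue_type R)).
  have := mf measurableT `[c, +oo[%classic (measurable_itv _).
  rewrite setTI; congr measurable; apply/seteqP.
  by split=> t /=; rewrite in_itv /= andbT.
have mge (n : nat) : measurable ([set t | n%:R <= `|f t|] : set (lebesgue_type R)).
  have -> : [set t | n%:R <= `|f t|] = [set t | n%:R <= f t] `|`
      f @^-1` `]-oo, - n%:R].
    apply/seteqP; split=> t /=; rewrite in_itv /= lerNr ler_normr.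
      by move=> /orP.
    by move=> /orP.
  apply: measurableU; first exact: msup.
  by have := mf measurableT `]-oo, - n%:R]%classic (measurable_itv _); rewrite setTI.
pose F n := [set t | n%:R <= `|f t|] `&` `[0, tau[%classic.
have mF n : measurable (F n : set (lebesgue_type R)).
  apply: measurableI; first exact: mge.
  by apply: measurable_caratheodory; exact: measurable_itv.
have F0 : \bigcap_n F n = set0.
  apply/seteqP; split=> t //= Ft.
  have [h _] := Ft (Num.bound `|f t|) I.
  by move: h; rewrite /= leNgt archi_boundP.
have [n nP] : exists n : nat, tmle [set t | n%:R <= `|f t|] e.
  have := @nonincreasing_cvg_mu _ (lebesgue_type R) R (@completed_lebesgue_measure R) F.
  rewrite F0 measure0 => H.
  have /fine_cvgP[[n1 _ fin] /cvgr0Pnorm_le/(_ _ e0)[n2 _ small]] :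
      (@completed_lebesgue_measure R) \o F @ \oo --> 0%E.
    apply: H => //.
    - apply: (@le_lt_trans _ _ (mu `[0, tau[%classic)); first by apply: mu_le => t [].
      by rewrite lebesgue_measure_itv /= lte_fin tau_gt0 ltry.
    - move=> m n mn; apply/subsetPset => t [/= h ?]; split => //=.
      by apply: le_trans h; rewrite ler_nat.
  exists (n1 + n2)%N; apply/tmleE.
  have f1 : mu (F (n1 + n2)%N) \is a fin_num by exact: fin _ (leq_addr n2 n1).
  have h : `|fine (mu (F (n1 + n2)%N))| <= e by exact: small _ (leq_addl n1 n2).
  change (mu (F (n1 + n2)%N) <= (tau * e)%:E)%E.
  rewrite -(fineK f1) lee_fin (le_trans (ler_norm _)) // (le_trans h) //.
  by rewrite ler_peMl ?(ltW e0) // -mulr_natl; have := @pi_ge2 R; lra.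
have [m m0 mP] := exists_inv_nat_lt 1 e0.
have mR : 0 < m%:R :> R by rewrite ltr0n.
(* Levels spaced by 1/m from -n to n. *)
pose K := (2 * n * m)%N.
pose g (t : R) : R := m%:R^-1 * \sum_(j < K) \1_[set t | j.+1%:R / m%:R - n%:R <= f t] t - n%:R.
exists (fun t => (g t)%:C).
  have sa k : trig_approx (fun t =>
      (\sum_(j < k) \1_[set t | j.+1%:R / m%:R - n%:R <= f t] t)%:C).
    elim: k => [|k IH].
      apply: trig_approx_ext (trig_approx_trigp (trigp_cst 0)) => t.
      by rewrite big_ord0.
    apply: trig_approx_ext (trig_approxD IH (indic_approx_measurable (msup (k.+1%:R / m%:R - n%:R)))) => t.
    by rewrite big_ord_recr /= rmorphD.
  apply: trig_approx_ext (trig_approxD (trig_approxZ (m%:R^-1)%:C (sa K))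
    (trig_approx_trigp (trigp_cst (- n%:R%:C)))) => t.
  by rewrite /g rmorphB rmorphM.
apply: tmle_sub nP => t _ /=; rewrite -rmorphB normc_real => h.
rewrite leNgt; apply/negP => fn; move: h; rewrite leNgt => /negP; apply.
move: fn; rewrite ltr_norml => /andP[f1 f2].
pose y := m%:R * (f t + n%:R).
have gE : g t = m%:R^-1 * \sum_(j < K) (if j.+1%:R <= y then 1 else 0) - n%:R.
  rewrite /g; congr (_ * _ - _); apply: eq_bigr => j _; rewrite indicE.
  have -> : (t \in [set t | j.+1%:R / m%:R - n%:R <= f t]) = (j.+1%:R <= y).
    have eq : (j.+1%:R / m%:R - n%:R <= f t) = (j.+1%:R <= y).
      by rewrite lerBlDr ler_pdivrMr // mulrC.
    by apply/idP/idP; rewrite inE /= eq.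
  by case: (_ <= _).
have y0 : 0 <= y by rewrite /y mulr_ge0 //; lra.
have yK : y <= K%:R.
  by rewrite /y /K natrM natrM mulrC ler_pM2r //; lra.
have [_ /(_ y0 yK)] := floor_sum y K.
rewrite gE; set S : R := \sum_(_ < _) _ => /andP[S1 S2].
have e1 : f t - (m%:R^-1 * S - n%:R) = (y - S) / m%:R.
  by rewrite /y; field; rewrite gt_eqF.
rewrite e1 ger0_norm; last by rewrite divr_ge0 //; lra.
apply: le_lt_trans mP; rewrite ler_pM2r ?invr_gt0 //; lra.
Qed.

Lemma trig_approx_L0 f : torus_L0 f -> trig_approx f.
Proof.
move=> [_ mR mI].
apply: trig_approx_ext (trig_approxD (trig_approx_real mR)
  (trig_approxZ 'i%C (trig_approx_real mI))) => t.
by rewrite -complexE.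
Qed.

End Density.

(** * Assembling the series *)

Section Assembly.
Context {R : realType}.
Implicit Types (Lambda : set int) (P S : seq (int * R[i])) (N M : int).

(** [correction] needs a trigonometric polynomial, so f is first replaced by F0; the last clause
    carries its bound on partial sums back to the residual f - S. *)
Lemma assembly_step Lambda f S N (e : R) : all_patterns Lambda -> trig_approx f ->
  0 < e -> exists x : int * seq (int * R[i]), [/\ N < x.1, spectrum Lambda N x.2,
    forall M, x.1 <= M -> trunc M x.2 = x.2,
    tmle [set t | e <= normc (f t - teval (S ++ x.2) t)] e
  & forall (a : R) M, tmle [set t | a <= normc (f t - teval S t)] a ->
      tmle [set t | a + e <= normc (teval (trunc M x.2) t)] (a + e)].
Proof.
move=> hL fa e0; have e20 : 0 < e / 2 by rewrite divr_gt0.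
have e40 : 0 < e / 4 by rewrite divr_gt0.
have [F0 tF0 aF0] := fa (e / 4) e40.
have tF : trigp (fun t => F0 t - teval S t).
  by apply: trigpB => //; exact: trigp_teval.
have [P [sP aP bP]] := correction N hL tF e20.
have [M0 NM0 M0P] := trunc_ge P (N + 1).
have aF : tmle [set t | e / 2 <= normc (f t - F0 t)] (e / 2).
  have h : e / 4 <= e / 2 by lra.
  by apply: (tmle_trans h); apply: tmle_sub aF0 => t _ /=; exact: le_trans h.
exists (M0, P); split => //=; first by rewrite (lt_le_trans _ NM0) // ltrDl.
  rewrite (splitr e); apply: (tmle_normcD _ aF aP) => t.
  apply: le_trans (normcD _ _); rewrite teval_cat le_eqVlt; apply/orP; left.
  by apply/eqP; congr normc; ring.
move=> a M aS; have h : (e / 4 + a) + e / 2 <= a + e by lra.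
have aSF : tmle [set t | e / 4 + a <= normc (F0 t - teval S t)] (e / 4 + a).
  apply: (tmle_normcD _ _ aS).
    by move=> t; apply: le_trans (normcD (F0 t - f t) _); rewrite addrA subrK.
  by apply: tmle_sub aF0 => t _ /=; rewrite normcB.
apply: (tmle_trans h); apply: tmle_sub (tmleU aSF (bP M)) => t _ /= H.
apply: contrapT => /not_orP[/negP h1 /negP h2]; rewrite -!ltNge in h1 h2; lra.
Qed.

(** A list may repeat a frequency, so coefficients are collected. All frequencies being positive,
    the symmetric cut |k| <= N is the cut k <= N. *)
Lemma partial_sum_teval Lambda S (c : int -> R[i]) (N : nat) t :
  spectrum Lambda 0 S ->
  (forall k, k <= N%:Z -> c k = \sum_(x <- S | x.1 == k) x.2) ->
  partial_sum Lambda c N t = teval (trunc N S) t.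
Proof.
move=> sS cE; rewrite /partial_sum.
set A := [set k | _].
have finA : finite_set A.
  pose r := [seq i%:Z | i <- iota 0 N.+1] ++ [seq - i%:Z | i <- iota 0 N.+1].
  apply: (@sub_finite_set _ _ [set` r]); last exact: finite_seq.
  move=> k [_ kN]; change (k \in r); rewrite mem_cat.
  have kN' : `|k|%N \in iota 0 N.+1 by rewrite mem_iota add0n; lia.
  have [k0|k0] := leP 0 k; apply/orP; [left|right]; apply/mapP; exists `|k|%N => //; lia.
rewrite fsbig_finite //= /teval /trunc big_filter.
transitivity (\sum_(k <- finmap.enum_fset (fset_set A)) \sum_(x <- S) (if x.1 == k then x.2 * character x.1 t else 0)).
  rewrite big_seq [RHS]big_seq; apply: eq_bigr => k.
  rewrite in_fset_set // inE => -[_ kN].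
  rewrite cE; last by rewrite (le_trans _ kN) // ler_norm.
  rewrite mulr_suml big_mkcond; apply: eq_bigr => x _.
  by case: eqP => // ->.
rewrite exchange_big [RHS]big_mkcond /= big_seq [RHS]big_seq.
apply: eq_bigr => x /sS[Lx x0].
case: ifPn => xN.
  rewrite (bigD1_seq x.1) ?finmap.fset_uniq //=.
  - by rewrite eqxx big1 ?addr0 // => k kx; rewrite eq_sym (negbTE kx).
  - rewrite in_fset_set // inE; split => //.
    by rewrite ger0_norm // ltW.
rewrite big1_seq // => k; rewrite /= in_fset_set // inE => -[_ kN].
by case: eqP kN => // <-; rewrite ger0_norm ?(negbTE xN) // ltW.
Qed.

Lemma torus_measure_fin (E : set R) d : tmle E d ->
  torus_measure E \is a fin_num.
Proof.
move=> Ed; rewrite ge0_fin_numE ?(le_lt_trans Ed) ?ltry //.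
rewrite /torus_measure mule_ge0 // ?lee_fin ?invr_ge0 ?ltW ?tau_gt0 //.
Qed.

Lemma menshov_of_all_patterns Lambda :
  (forall f : R -> R[i], torus_L0 f -> trig_approx f) ->
  all_patterns Lambda -> menshov_spectrum_in_measure R Lambda.
Proof.
move=> dense hL f /dense fa.
pose e (n : nat) : R := n.+1%:R^-1.
have e0 n : 0 < e n by rewrite invr_gt0.
have ele n m : (n <= m)%N -> e m <= e n.
  by move=> nm; rewrite lef_pV2 ?posrE // ler_nat.
pose nxt n (s : int * seq (int * R[i])) :=
  projT1 (cid (assembly_step s.2 s.1 hL fa (e0 n))).
pose fix st n := if n is n'.+1 then
  ((nxt n' (st n')).1, (st n').2 ++ (nxt n' (st n')).2) else (0, [::]).
pose N n := (st n).1; pose S n := (st n).2; pose P n := (nxt n (st n)).2.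
have SS n : S n.+1 = S n ++ P n by [].
have stP n : [/\ N n < N n.+1, spectrum Lambda (N n) (P n),
    forall M, N n.+1 <= M -> trunc M (P n) = P n,
    tmle [set t | e n <= normc (f t - teval (S n.+1) t)] (e n)
  & forall (a : R) M, tmle [set t | a <= normc (f t - teval (S n) t)] a ->
      tmle [set t | a + e n <= normc (teval (trunc M (P n)) t)] (a + e n)].
  exact: projT2 (cid (assembly_step (st n).2 (st n).1 hL fa (e0 n))).
have nN n : n%:Z <= N n.
  elim: n => [//|n IH]; have [h _ _ _ _] := stP n; lia.
have NN n m : N n <= N (n + m)%N.
  elim: m => [|m IH]; first by rewrite addn0.
  by rewrite addnS (le_trans IH) // ltW //; have [] := stP (n + m)%N.
have truncS n M : N n <= M -> trunc M (S n) = S n.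
  elim: n => [//|n IH] h; have [h1 _ h2 _ _] := stP n.
  by rewrite SS trunc_cat IH ?h2 // (le_trans (ltW h1)).
have spS n : spectrum Lambda 0 (S n).
  elim: n => [//|n IH]; rewrite SS; apply: spectrum_cat => //.
  by apply: spectrum_le (_ : spectrum Lambda (N n) _); [exact: le_trans (nN n)|have [] := stP n].
(* Stage |k| already settles the coefficient of k: as |k| <= N |k|, later stages only add larger
   frequencies. *)
pose c (k : int) := \sum_(x <- S `|k|%N | x.1 == k) x.2.
have cS n m (k : int) : k <= N n ->
    \sum_(x <- S (n + m)%N | x.1 == k) x.2 = \sum_(x <- S n | x.1 == k) x.2.
  move=> kn; elim: m => [|m IH]; first by rewrite addn0.
  rewrite addnS SS big_cat /= IH [X in _ + X]big1_seq ?addr0 // => x /andP[/eqP xk xP].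
  have [_ /(_ x xP)[_ xN] _ _ _] := stP (n + m)%N.
  by have := NN n m; move: xN; rewrite xk; lia.
have psE (M n : nat) t : (M <= n)%N -> partial_sum Lambda c M t = teval (trunc M (S n)) t.
  move=> Mn; apply: partial_sum_teval => // k kM; rewrite /c.
  have [kn|kn] := leqP `|k|%N n.
    rewrite -(cS `|k|%N (n - `|k|)%N k) ?subnKC //.
    by rewrite (le_trans _ (nN _)) // lez_abs.
  rewrite -(cS n (`|k| - n)%N k) ?subnKC //; first exact: ltnW.
  by rewrite (le_trans kM) // (le_trans _ (nN n)).
(* A cut beyond [N n.+1] falls in at most one later correction. The residual before it and the
   truncated correction, itself bounded by that residual, give at most 3 e n. *)
have main n m (M : int) : N n.+1 <= M ->
    tmle [set t | 4 * e n <= normc (f t - teval (trunc M (S (n.+1 + m)%N)) t)] (4 * e n).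
  move=> nM; elim: m => [|m IH].
    rewrite addn0 truncS //; have [_ _ _ h _] := stP n.
    have h4 : e n <= 4 * e n by have := e0 n; lra.
    by apply: (tmle_trans h4); apply: tmle_sub h => t _ /=; exact: le_trans h4.
  rewrite addnS SS trunc_cat; have [_ sP _ _ bP] := stP (n.+1 + m)%N.
  have [NM|MN] := leP (N (n.+1 + m)%N) M; last first.
    by rewrite (trunc_lt sP (ltW MN)) cats0.
  rewrite truncS //; have [_ _ _ aS _] := stP (n + m)%N.
  rewrite -addSn in aS; have eb := bP _ M aS.
  have h : e (n + m)%N + (e (n + m)%N + e (n.+1 + m)%N) <= 4 * e n.
    have := ele n (n + m)%N (leq_addr _ _); have := ele n (n.+1 + m)%N.
    by rewrite addSn leqW ?leq_addr // => /(_ isT); have := e0 n; lra.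
  have H : tmle [set t | e (n + m)%N + (e (n + m)%N + e (n.+1 + m)%N) <=
      normc (f t - teval (S (n.+1 + m)%N ++ trunc M (P (n.+1 + m)%N)) t)]
      (e (n + m)%N + (e (n + m)%N + e (n.+1 + m)%N)).
    apply: (tmle_normcD _ aS eb) => t.
    by rewrite teval_cat opprD addrA (le_trans (normcD _ _)) // normcNE.
  by apply: (tmle_trans h); apply: tmle_sub H => t _ /=; exact: le_trans h.
exists c => eps eps0.
pose E (M : nat) := [set t | eps%:C <= `|partial_sum Lambda c M t - f t|].
have Esmall (d : R) : 0 < d -> \forall M \near \oo, tmle (E M) d.
  move=> d0; have de0 : 0 < Num.min d eps by rewrite lt_min d0.
  have [n n0 nP] := exists_inv_nat_lt 4 de0.
  have : 4 * e n < Num.min d eps.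
    by apply: le_lt_trans nP; rewrite ler_pM2l // lef_pV2 ?posrE ?ltr0n // ler_nat.
  rewrite lt_min => /andP[nd neps].
  exists `|N n.+1|%N => // M /= nM.
  have NM : N n.+1 <= M%:Z by have := nN n.+1; lia.
  apply: (tmle_trans (ltW nd)); apply: tmle_sub (main n M M%:Z NM) => t _ /=.
  rewrite /E /= (psE M (n.+1 + M)%N) ?leq_addl // lec_normc normcB.
  exact/le_trans/ltW.
apply/fine_cvgP; split.
  by apply: filterS (Esmall 1 ltr01) => M; exact: torus_measure_fin.
apply/cvgr0Pnorm_le => d d0; apply: filterS (Esmall d d0) => M Md /=.
have := torus_measure_fin Md; move: Md; rewrite /tmle.
have : (0 <= torus_measure (E M))%E.
  rewrite /torus_measure mule_ge0 // ?lee_fin ?invr_ge0 ?ltW ?tau_gt0 //.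
by case: (torus_measure (E M)) => //= r; rewrite !lee_fin => r0 rd _; rewrite ger0_norm.
Qed.

End Assembly.

(** * The perturbation of the squares *)

Section Perturbation.
Context {R : realType}.
Implicit Types (D : seq (int * int)).

Let bnd D : nat := (\sum_(x <- D) (`|x.1| + `|x.2|))%N.

Let bndP D x : x \in D -> (`|x.1| <= bnd D)%N /\ (`|x.2| <= bnd D)%N.
Proof.
move=> xD; rewrite /bnd (big_rem x) //=.
by split; rewrite -addnA ?leq_addr // addnCA leq_addr.
Qed.

(** The perturbation s - j^2 that moves (A + j)^2 to A^2 + 2Aj + s; integers j outside the pattern
    get 0. *)
Let shift D (j : int) : int :=
  if [seq x.2 | x <- D & x.1 == j] is s :: _ then s - j ^+ 2 else 0.

Let shift_le D j : (`|shift D j| <= bnd D + bnd D ^ 2)%N.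
Proof.
rewrite /shift; case E : [seq _ | _ <- _ & _] => [//|s l].
have : s \in [seq x.2 | x <- D & x.1 == j] by rewrite E mem_head.
move=> /mapP[x]; rewrite mem_filter => /andP[/eqP xj /bndP[h1 h2]] ->.
rewrite -xj; have h3 : (`|x.1 ^+ 2| <= bnd D ^ 2)%N by rewrite abszX leq_exp2r.
have tri (u v : int) (p q : nat) : (`|u| <= p)%N -> (`|v| <= q)%N -> (`|u - v| <= p + q)%N.
  by lia.
exact: tri h2 h3.
Qed.

Let shiftE D x : uniq [seq x.1 | x <- D] -> x \in D -> shift D x.1 = x.2 - x.1 ^+ 2.
Proof.
move=> uD xD; rewrite /shift; case E : [seq _ | _ <- _ & _] => [|s l].
  have : x.2 \in [seq y.2 | y <- D & y.1 == x.1].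
    by apply: map_f; rewrite mem_filter eqxx.
  by rewrite E.
have : s \in [seq y.2 | y <- D & y.1 == x.1] by rewrite E mem_head.
move=> /mapP[y]; rewrite mem_filter => /andP[/eqP yx yD] ->.
suff -> : y = x by [].
have iy : (index y D < size [seq x.1 | x <- D])%N by rewrite size_map index_mem.
have ix : (index x D < size [seq x.1 | x <- D])%N by rewrite size_map index_mem.
have /eqP ii : index y D == index x D.
  by rewrite -(nth_uniq 0 iy ix uD) !(nth_map x) ?index_mem // !nth_index // yx.
by have := nth_index x yD; rewrite ii nth_index.
Qed.

(** All pairs of a pattern and a lower bound are enumerated, and the n-th pair is realized in its
    own window of integers k, centred so late that w dominates its shifts. *)
Lemma exists_perturbation (w : nat -> R) : w k @[k --> \oo] --> +oo ->
  exists r : nat -> int, (fun k : nat => (r k)%:~R : R) =o_\oo w /\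
    let Lambda := [set (k%:Z ^+ 2 + r k)%R | k in [set k : nat | (1 <= k)%N]] in
    Lambda `<=` [set n : int | 0 < n] /\ all_patterns Lambda.
Proof.
move=> hw.
pose T := (seq (int * int) * nat)%type.
(* Integers that encode nothing get the empty pattern. *)
pose task n : T := odflt ([::], 0%N) (unpickle n).
pose D n := (task n).1; pose B n := bnd (D n); pose M n := (B n + B n ^ 2)%N.
(* This makes |r k| / w k at most 1 / (n + 1) on window n. *)
have bex n : exists b : nat, forall k, (b <= k)%N -> (n.+1 * (M n).+1)%:R <= w k.
  by have /cvgryPge/(_ (n.+1 * (M n).+1)%:R)[b _ bP] := hw; exists b => k; exact: bP.
have [b bP] := choice bex.
(* The summands ensure in turn the growth of w, k > M n and hence k^2 + r k > 0, the lower bound of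
   the task, and k >= 1. *)
pose start n := (b n + M n + (task n).2 + 1)%N.
(* The window leaves room for A + j with |j| <= B and A = a n + B n. *)
pose fix a n := if n is n'.+1 then (a n' + (B n').*2 + 1 + start n)%N else start 0%N.
have a_start n : (start n <= a n)%N by case: n => [//|n] /=; rewrite leq_addl.
have aS n : (a n + (B n).*2 < a n.+1)%N by rewrite /= addn1 addSn ltnS leq_addr.
have a_lt n m : (a n < a m)%N -> (n < m)%N.
  rewrite ltnNge => h; rewrite ltnNge; apply: contra h => mn.
  rewrite -(subnKC mn); elim: (n - m)%N => [|i IH]; first by rewrite addn0.
  by rewrite addnS (leq_trans IH) // ltnW // (leq_ltn_trans (leq_addr _ _) (aS _)).
pose win k n := (a n <= k < a n.+1)%N.
pose r k := if pselect (exists n, win k n) is left H then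
  let n := projT1 (cid H) in shift (D n) (k%:Z - (a n + B n)%N%:Z) else 0.
have rE k n : win k n -> r k = shift (D n) (k%:Z - (a n + B n)%N%:Z).
  move=> kn; rewrite /r; case: pselect => [H|[]]; last by exists n.
  case: cid => m /= /andP[m1 m2]; move/andP: kn => [n1 n2].
  have mn : (m < n.+1)%N by apply: a_lt; exact: leq_ltn_trans n2.
  have nm : (n < m.+1)%N by apply: a_lt; exact: leq_ltn_trans m2.
  have -> // : m = n by apply/eqP; rewrite eqn_leq; apply/andP.
have rP k : r k = 0 \/ exists n, win k n /\ (`|r k| <= M n)%N.
  have [[n kn]|h] := pselect (exists n, win k n).
    by right; exists n; split => //; rewrite (rE _ _ kn) shift_le.
  by left; rewrite /r; case: pselect.
exists r; split; last split.
- apply/eqoP => e e0; have [n0 n00 nP] := exists_inv_nat_lt 1 e0.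
  exists (a n0) => // k /= kn.
  have [->|[n [kw rM]]] := rP k; first by rewrite normr0 mulr_ge0 // ltW.
  have nn : (n0 <= n)%N.
    by rewrite -ltnS; apply: a_lt; case/andP: kw => _; exact: leq_ltn_trans.
  have /bP wk : (b n <= k)%N.
    case/andP: kw => h _; apply: leq_trans h; apply: leq_trans (a_start n).
    by rewrite /start -!addnA leq_addr.
  have w0 : 0 <= w k by apply: le_trans wk.
  rewrite (ger0_norm w0) -intr_norm -natr_absz.
  have h1 : (`|r k|%N)%:R <= (M n).+1%:R :> R by rewrite ler_nat leqW.
  apply: le_trans h1 _; rewrite natrM in wk.
  have n0R : 0 < n0%:R :> R by rewrite ltr0n.
  have h2 : 1 <= e * n.+1%:R.
    rewrite ltr_pdivrMr // in nP; apply: le_trans (ltW nP) _.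
    by rewrite ler_pM2l // ler_nat leqW.
  have M0 : 0 <= (M n).+1%:R :> R by [].
  nra.
- move=> _ [k /= k1 <-].
  have [->|[n [/andP[kn _] rM]]] := rP k; first by rewrite addr0 exprn_gt0.
  have : (M n < k)%N.
    apply: leq_trans kn; apply: leq_trans (a_start n).
    by rewrite /start addn1 ltnS -addnA addnCA leq_addr.
  have : k%:Z <= k%:Z ^+ 2 by rewrite expr2 ler_peMr.
  by move: (_ ^+ 2) => y; lia.
- move=> D0 uD N0; pose n := pickle ((D0, N0) : T).
  have tn : task n = (D0, N0) by rewrite /task pickleK.
  have DE : D n = D0 by rewrite /D tn.
  exists (a n + B n)%N.
    rewrite (leq_trans _ (leq_addr _ _)) // (leq_trans _ (a_start n)) // /start tn /=.
    by rewrite addn1 leqW // leq_addl.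
  move=> x xD; have [h1 _] := bndP xD.
  have h1' : (`|x.1| <= B n)%N by rewrite /B DE.
  have a1 : (1 <= a n)%N by rewrite (leq_trans _ (a_start n)) // /start addn1.
  have [k kE] : exists k : nat, k%:Z = (a n + B n)%N%:Z + x.1.
    by exists `|((a n + B n)%N%:Z + x.1)%R|%N; lia.
  have kw : win k n by rewrite /win; have := aS n; rewrite -addnn => ?; apply/andP; split; lia.
  exists k => /=; first by case/andP: kw => ? _; exact: leq_trans a1 _.
  rewrite (rE _ _ kw) DE (_ : _ - _ = x.1); last by rewrite kE addrC addKr.
  by rewrite shiftE // kE; ring.
Qed.

End Perturbation.

Local Close Scope complex_scope.
Unset Implicit Arguments.

Theorem theorem7 (R : realType) (w : nat -> R) (hw : w k @[k --> \oo] --> +oo) :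
  exists r : nat -> int,
    (fun k : nat => (r k)%:~R : R) =o_\oo w /\
    let Lambda := [set (k%:Z ^+ 2 + r k)%R | k in [set k : nat | (1 <= k)%N]] in
    Lambda `<=` [set n : int | 0 < n] /\
    menshov_spectrum_in_measure R Lambda.
Proof.
have [r [ro [pos pat]]] := exists_perturbation hw.
exists r; split => //; split => //.
exact: (menshov_of_all_patterns (@trig_approx_L0 R) pat).
Qed.
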